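(* Let $k\in\mathbb{N}$ and $f\in L^1_{\rm loc}(\mathbb{R}^n)$. Then there exists a positive constant $C_{(n,k)}$, depending only on $n$ and $k$, such that, for almost every $x\in\mathbb{R}^n$ and for any $r\in(0,\infty)$ and any ball $B_1\subset B:=B(x,r)\subset3B_1$, $$\left|f(x)-P^{(k-1)}_{B_1}(f)(x)\right|\le C_{(n,k)}\sum_{j\in\mathbb{Z}_+}\frac1{|2^{-j}B|}\int_{2^{-j}B}\left|f(y)-P^{(k-1)}_{2^{-j}B}(f)(y)\right|dy.$$
   Context: $\mathbb{Z}_+=\{0,1,2,\ldots\}$. For a ball $B$ and $\lambda>0$, $\lambda B$ is the ball with the same center and $\lambda$ times the radius. For $f\in L^1_{\rm loc}(\mathbb{R}^n)$, $s\in\mathbb{Z}_+$ and a ball $B$, $P^{(s)}_B(f)$ is the unique polynomial on $\mathbb{R}^n$ of degree at most $s$ such that $\int_B[f(x)-P^{(s)}_B(f)(x)]x^\alpha\,dx=0$ for all $\alpha\in\mathbb{Z}_+^n$ with $|\alpha|\le s$. *)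

(* Defs.v *)
From HB Require Import structures.
From mathcomp Require Import all_boot all_order all_algebra.
(* mpoly comes first and without its notations, which clash with those of
   mathcomp-analysis; its isMeasure would shadow that of mathcomp-analysis. *)
From mathcomp Require Import -(notations) mpoly.
From mathcomp Require Import all_classical all_reals all_analysis.

Set Implicit Arguments.
Unset Strict Implicit.
Unset Printing Implicit Defensive.

Import Order.TTheory GRing.Theory Num.Theory.
Import numFieldNormedType.Exports.

Local Open Scope classical_set_scope.
Local Open Scope ring_scope.

Definition rV_display : measure_display.
Proof. exact: default_measure_display. Qed.

(* The Borel sigma-algebra of R^n, generated by the coordinate projections. *)
Section measurable_rV.
Context {R : realType} (n : nat).

Let coord_rV : 'I_n -> 'rV[R]_n -> R := fun i x => x ord0 i.

Let rV_set0 : g_sigma_preimage coord_rV set0.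
Proof. exact: sigma_algebra0. Qed.

Let rV_setC A : g_sigma_preimage coord_rV A -> g_sigma_preimage coord_rV (~` A).
Proof. exact: sigma_algebraC. Qed.

Let rV_bigcup (F : _^nat) : (forall i, g_sigma_preimage coord_rV (F i)) ->
  g_sigma_preimage coord_rV (\bigcup_i (F i)).
Proof. exact: sigma_algebra_bigcup. Qed.

HB.instance Definition _ := @isMeasurable.Build rV_display
  'rV[R]_n (g_sigma_preimage coord_rV) rV_set0 rV_setC rV_bigcup.

Lemma measurable_coord_rV (i : 'I_n) :
  measurable_fun [set: 'rV[R]_n] (fun x : 'rV[R]_n => x ord0 i).
Proof.
move=> _ Y mY; rewrite setTI; apply: sub_sigma_algebra => /=.
rewrite -bigcup_seq/=; exists i => /=; first by rewrite mem_index_enum.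
by exists Y => //; rewrite setTI.
Qed.

Lemma measurable_fun_rV d (T : measurableType d) (f : T -> 'rV[R]_n) :
  (forall i, measurable_fun [set: T] (fun t => f t ord0 i)) ->
  measurable_fun [set: T] f.
Proof.
move=> mf; suff fS : g_sigma_preimage (fun i => coord_rV i \o f) `<=` measurable.
  by move=> _ A mA; apply: fS; rewrite g_sigma_preimage_comp; exists A.
apply: smallest_sub; first exact: sigma_algebra_measurable.
rewrite -bigcup_seq; apply: bigcup_sub => i _ A [B mB <-]; exact: mf.
Qed.

End measurable_rV.

Section lebesgue_rV.
Context {R : realType}.
Local Open Scope ereal_scope.

Definition rV_cons n (p : measurableTypeR R * 'rV[R]_n) : 'rV[R]_n.+1 :=
  row_mx (p.1 : R)%:M p.2.

Lemma measurable_rV_cons n : measurable_fun setT (@rV_cons n).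
Proof.
apply: measurable_fun_rV => i.
rewrite /rV_cons; under eq_fun do rewrite mxE.
case: splitP => j ij.
  rewrite (_ : (fun _ => _) = fst); first exact: measurable_fst.
  by apply/funext => p; rewrite mxE !ord1 eqxx mulr1n.
exact: measurableT_comp (measurable_coord_rV j) measurable_snd.
Qed.

Let rV_uncons n (x : 'rV[R]_n.+1) : measurableTypeR R * 'rV[R]_n :=
  (x ord0 ord0, \row_j x ord0 (lift ord0 j)).

Let rV_consK n : cancel (@rV_cons n) (@rV_uncons n).
Proof.
case=> t v; rewrite /rV_uncons /rV_cons/=; congr pair.
  rewrite mxE; case: splitP => // j _.
  by rewrite mxE !ord1 eqxx mulr1n.
apply/rowP => j; rewrite mxE -[RHS](row_mxEr t%:M v ord0 j).
by congr (row_mx _ _ _ _); exact: val_inj.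
Qed.

Let measurable_rV_uncons n : measurable_fun setT (@rV_uncons n).
Proof.
apply/measurable_fun_pairP; split => /=.
  exact: measurable_coord_rV.
apply: measurable_fun_rV => i.
by under eq_fun do rewrite mxE; exact: measurable_coord_rV.
Qed.

Section lebesgue_cons.
Variables (n : nat) (mu : {sigma_finite_measure set 'rV[R]_n -> \bar R}).

Definition lebesgue_cons : set 'rV[R]_n.+1 -> \bar R :=
  pushforward (@lebesgue_measure R \x mu) (@rV_cons n).

Let lebesgue_cons0 : lebesgue_cons set0 = 0.
Proof. exact: (measure0 (@lebesgue_measure R \x mu)). Qed.

Let lebesgue_cons_ge0 A : 0 <= lebesgue_cons A.
Proof. exact: (measure_ge0 (@lebesgue_measure R \x mu)). Qed.

Let lebesgue_cons_sigma_additive : semi_sigma_additive lebesgue_cons.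
Proof.
move=> F mF tF mUF; rewrite /lebesgue_cons.
exact: (@measure_semi_sigma_additive _ _ _
  (measure_function_pushforward__canonical__measure_function_Measure
    (@lebesgue_measure R \x mu) (@measurable_rV_cons n))).
Qed.

HB.instance Definition _ := isMeasure.Build _ _ _ lebesgue_cons
  lebesgue_cons0 lebesgue_cons_ge0 lebesgue_cons_sigma_additive.

Let lebesgue_cons_sigma_finite : sigma_finite setT lebesgue_cons.
Proof.
have /sigma_finiteP[F [TF ndF Foo]] := sigma_finiteT (@lebesgue_measure R).
have /sigma_finiteP[G [TG ndG Goo]] := sigma_finiteT mu.
exists (fun k => @rV_uncons n @^-1` (F k `*` G k)) => [|k].
  rewrite -preimage_bigcup -[LHS](preimage_setT (@rV_uncons n)); congr (_ @^-1` _).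
  rewrite -setXTT TF TG; apply/seteqP; split=> [[x y] [/= [i _ Fix] [j _ Gjy]]|].
    exists (maxn i j) => //; split.
    - by move: x Fix; exact/subsetPset/ndF/leq_maxl.
    - by move: y Gjy; exact/subsetPset/ndG/leq_maxr.
  by move=> [x y] [i _ [/= Fix Giy]]; split; exists i.
have [mF Fkoo] := Foo k; have [mG Gkoo] := Goo k; split.
  rewrite -[X in measurable X]setTI; apply: measurable_rV_uncons => //.
  exact: measurableX.
rewrite /lebesgue_cons /pushforward (_ : _ @^-1` _ = F k `*` G k).
  by rewrite product_measure1E// lte_mul_pinfty// ge0_fin_numE.
by apply/funext => p; exact: (congr1 (F k `*` G k) (rV_consK p)).
Qed.

HB.instance Definition _ := @Measure_isSigmaFinite.Build _ _ _ lebesgue_cons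
  lebesgue_cons_sigma_finite.

End lebesgue_cons.

Fixpoint lebesgue_borel_rV n : {sigma_finite_measure set 'rV[R]_n -> \bar R} :=
  if n is m.+1 then lebesgue_cons (lebesgue_borel_rV m)
  else \d_(0%R : 'rV[R]_0).

(* Carathéodory's construction applied to the Borel measure gives its
   completion: all Lebesgue measurable sets, not only the Borel ones. *)
Definition lebesgueType n : measurableType _ :=
  caratheodory_type ((lebesgue_borel_rV n)^*)%mu.

Definition lebesgue_rV n : set (lebesgueType n) -> \bar R :=
  @completed_measure_extension _ _ _ (lebesgue_borel_rV n).

HB.instance Definition _ n := Measure.on (@lebesgue_rV n).

Let lebesgue_rV_sigma_finite n : sigma_finite setT (@lebesgue_rV n).
Proof. exact/completed_measure_extension_sigma_finite/sigma_finiteT. Qed.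

HB.instance Definition _ n := @Measure_isSigmaFinite.Build _ _ _
  (@lebesgue_rV n) (@lebesgue_rV_sigma_finite n).

End lebesgue_rV.
Arguments lebesgueType R n : clear implicits.
Arguments lebesgue_borel_rV R n : clear implicits.
Arguments lebesgue_rV R n _ : clear implicits.

Section defs.
Context {R : realType} {n : nat}.
Implicit Types (f : 'rV[R]_n -> R) (x c : 'rV[R]_n) (r : R) (B : set 'rV[R]_n).
Implicit Types (p : mpoly n R) (a : multinom n) (s : nat).

(* The norm and balls of the library on 'rV[R]_n are those of the sup norm. *)
Definition enorm x : R := Num.sqrt (\sum_(i < n) x ord0 i ^+ 2).

Definition eball c r : set 'rV[R]_n := [set y | enorm (y - c) < r].

Definition L1loc f : Prop :=
  measurable_fun [set: lebesgueType R n] (f : lebesgueType R n -> R) /\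
  forall K : set 'rV[R]_n, compact K ->
    (\int[lebesgue_rV R n]_(x in K) `|f x|%:E < +oo)%E.

Definition evalp p x : R := meval (fun i => x ord0 i) p.

(* msize is the degree plus one, and mdeg a is |a|. *)
Definition is_mproj s f B p : Prop :=
  (msize p <= s.+1)%N /\
  forall a, (mdeg a <= s)%N ->
    (\int[lebesgue_rV R n]_(x in B)
       ((f x - evalp p x) * \prod_(i < n) x ord0 i ^+ a i)%:E = 0)%E.

(* P_B^(s)(f); such a polynomial exists and is unique when f is locally
   integrable and B is a ball, so the default value 0 plays no role there. *)
Definition mproj s f B : mpoly n R := xget 0 [set p | is_mproj s f B p].

Definition avg f B : \bar R :=
  ((lebesgue_rV R n B)^-1 * \int[lebesgue_rV R n]_(y in B) `|f y|%:E)%E.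

End defs.

(* Main.v *)
Require Import Defs.
From mathcomp Require Import all_boot all_order all_algebra.
From mathcomp Require Import -(notations) mpoly.
From mathcomp Require Import all_classical all_reals all_analysis measurable_realfun.
From mathcomp Require Import ring lra.

Set Implicit Arguments.
Unset Strict Implicit.
Unset Printing Implicit Defensive.

Import Order.TTheory GRing.Theory Num.Theory.
Import numFieldNormedType.Exports.

Local Open Scope classical_set_scope.
Local Open Scope ring_scope.

(** The estimate is a telescoping argument along the balls B_j = B(x, 2^-j r).
    With s = k - 1 and P_j the projection of f on B_j,

      f(x) - P_(B1)(x) = (f(x) - P_J(x)) + sum_(j < J) (P_(j+1) - P_j)(x)
                         + (P_0 - P_(B1))(x).

    One inequality, [mproj_sub_le], controls every term: if p is the projection
    of f on a ball B and q is any polynomial of degree at most s, then |p - q| is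
    at most C times the average of |f - q| on B, at every point of 3B. It is
    used with q = P_j on B_(j+1), with q = P_0 on B1 (here x need not be in
    B1, but it is in 3B1), and with the constant q = f(x) on B_J. Averages over a
    ball are bounded by those over a larger ball of comparable volume, so the
    first two kinds of terms are bounded by averages of |f - P_j| on B_j, and
    the last one tends to 0 as J grows when x is a Lebesgue point of f.

    Behind [mproj_sub_le] is the equivalence of the sup norm and the L^2 norm on
    polynomials of degree at most s, uniformly in the ball: the square of
    sup_B |h| is at most a constant times the average of h^2 on B
    ([sup_mpoly_le_L2]). Instead of rescaling to the unit ball, one observes
    that along a line h is a univariate polynomial, whose coefficients are
    controlled by its values ([coef_bounded_by_values]); so h stays comparable to
    its supremum on a ball of radius eta r, with eta depending on s only
    ([mpoly_concentration]). The same fact shows that projections exist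
    ([mproj_exists]).

    That almost every point is a Lebesgue point
    ([lebesgue_differentiation_rV]) follows from a covering inequality and outer
    regularity. For fixed q and eps, let E be the set of points where
    |f - q| < eps while |f - q| has averages above 2 * 3^n * eps on arbitrarily
    small balls. Covering E by such balls inside an open set barely larger than
    E gives mu(E) <= mu(E) / 2 + error, so E is null ([bad_set_null]); letting q
    and eps range over countable sets proves the claim. This part is carried out
    with balls of the sup norm, whose volume is (2r)^n and which are comparable
    with Euclidean balls. *)

(** * Univariate polynomials bounded on an interval *)

Section univariate.
Context {R : realType}.

(** The coefficients are the image of the values at s + 1 fixed nodes under the
    inverse of a Vandermonde matrix, so the constant depends on the degree
    only. The nodes i / (s + 1) lie in the half-open interval because open balls
    only control a polynomial strictly before the boundary. *)
Lemma coef_bounded_by_values s : exists2 K : R, 0 < K &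
  forall (q : {poly R}) (M : R), (size q <= s.+1)%N ->
    (forall t, 0 <= t < 1 -> `|q.[t]| <= M) -> forall i, `|q`_i| <= K * M.
Proof.
pose a : 'rV[R]_s.+1 := \row_j (j%:R / s.+1%:R).
pose V := Vandermonde s.+1 a.
have Vunit : V \in unitmx.
  rewrite unitmxE unitfE det_Vandermonde; apply/prodf_neq0 => i _.
  apply/prodf_neq0 => j ij; rewrite !mxE -mulrBl mulf_neq0 ?invr_eq0 ?pnatr_eq0//.
  by rewrite subr_eq0 eqr_nat gtn_eqF.
exists (1 + \sum_i \sum_j `|invmx V j i|).
  by rewrite ltr_pwDl// sumr_ge0// => i _; exact: sumr_ge0.
move=> q M sq qM i.
have M0 : 0 <= M by apply: le_trans (qM 0 _) => //; rewrite lexx ltr01.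
have [si|si] := ltnP i s.+1; last first.
  rewrite nth_default ?normr0 ?(leq_trans sq)// mulr_ge0// addr_ge0//.
  by rewrite sumr_ge0// => k _; exact: sumr_ge0.
pose io := Ordinal si.
pose c : 'rV[R]_s.+1 := \row_i q`_i.
pose v : 'rV[R]_s.+1 := \row_j q.[a 0 j].
have cV : c *m V = v.
  apply/rowP => j; rewrite !mxE (horner_coef_wide _ sq).
  by apply: eq_bigr => k _; rewrite !mxE.
have cE : c = v *m invmx V by rewrite -cV mulmxK.
have -> : q`_i = c 0 io by rewrite mxE.
rewrite cE mxE mulrDl mul1r (le_trans (ler_norm_sum _ _ _))//.
apply: (@le_trans _ _ ((\sum_j `|invmx V j io|) * M)).
  rewrite mulr_suml; apply: ler_sum => j _; rewrite normrM mulrC.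
  rewrite ler_wpM2l// !mxE; apply: qM.
  by rewrite divr_ge0//= ltr_pdivrMr ?mul1r ?ltr_nat.
rewrite -[leLHS]add0r lerD// ler_wpM2r//.
rewrite [leRHS](bigD1 io)//= lerDl sumr_ge0// => k _; exact: sumr_ge0.
Qed.

End univariate.

(** * Polynomials on Euclidean balls *)

Section mpoly_lines.
Context {R : realType} {n : nat}.
Implicit Types (p : mpoly n R) (x y v c : 'rV[R]_n).

Lemma evalpB p q x : evalp (p - q) x = evalp p x - evalp q x.
Proof. exact: mevalB. Qed.

(** Restriction to a line reduces estimates on polynomials in n variables to
    univariate ones of no larger degree. *)
Lemma evalp_line p x v : exists q : {poly R}, (size q <= msize p)%N /\
  forall t, q.[t] = evalp p (x + t *: v).
Proof.
pose L i : {poly R} := (x ord0 i)%:P + (v ord0 i) *: 'X.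
exists (\sum_(m <- msupp p) mcoeff m p *: \prod_i L i ^+ (m i)); split.
  rewrite -[leqRHS]add0n; apply: leq_trans (size_sum _ _ _) _.
  apply/bigmax_leqP_seq => m mp _.
  apply: leq_trans (size_scale_leq _ _) _.
  apply: leq_trans (msize_mdeg_lt mp).
  rewrite mdegE.
  elim/big_ind2 : _ => [|a k b l|i _]; first by rewrite size_poly1.
    move=> ak bl; apply: leq_trans (size_polyMleq _ _) _.
    by rewrite -subn1 leq_subLR add1n -addSn -addnS leq_add.
  apply: leq_trans (size_poly_exp_leq _ _) _.
  rewrite ltnS -[leqRHS]mul1n leq_mul2r; apply/orP; right.
  rewrite -subn1 leq_subLR addn1.
  rewrite (leq_trans (size_polyD _ _))// geq_max (leq_trans (size_polyC_leq1 _))//=.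
  by rewrite (leq_trans (size_scale_leq _ _))// size_polyX.
move=> t; rewrite horner_sum /evalp mevalE; apply: eq_bigr => m _.
rewrite hornerZ; congr (_ * _); rewrite horner_prod; apply: eq_bigr => i _.
by rewrite horner_exp !hornerE !mxE mulrC.
Qed.

Lemma evalp_bounded p c (r : R) : 0 <= r ->
  exists M, forall y, (forall i, `|y ord0 i - c ord0 i| <= r) ->
    `|evalp p y| <= M.
Proof.
move=> r0.
exists (\sum_(m <- msupp p) `|mcoeff m p| * \prod_i (`|c ord0 i| + r) ^+ m i).
move=> y yc; rewrite /evalp mevalE (le_trans (ler_norm_sum _ _ _))//.
apply: ler_sum => m _; rewrite normrM ler_wpM2l// normr_prod.
apply: ler_prod => i _; rewrite normr_ge0 normrX lerXn2r// ?nnegrE ?addr_ge0//.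
by rewrite -[y ord0 i](subrK (c ord0 i)) addrC (le_trans (ler_normD _ _))// lerD2l.
Qed.

Lemma eballP c r y : 0 < r ->
  eball c r y <-> \sum_(i < n) (y ord0 i - c ord0 i) ^+ 2 < r ^+ 2.
Proof.
move=> r0; rewrite /eball /enorm /=.
under eq_bigr do rewrite !mxE.
set S := \sum_i _.
by rewrite -[X in _ < X <-> _](gtr0_norm r0) -sqrtr_sqr ltr_sqrt ?exprn_gt0.
Qed.

Lemma eball_radius_gt0 c r y : eball c r y -> 0 < r.
Proof. by rewrite /eball/=; apply: le_lt_trans; exact: sqrtr_ge0. Qed.

Lemma eball_coord c r y i : eball c r y -> `|y ord0 i - c ord0 i| < r.
Proof.
move=> yc; have r0 := eball_radius_gt0 yc; move: yc => /(eballP _ _ r0) yc.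
rewrite -[ltRHS](gtr0_norm r0) -ltr_sqr ?nnegrE// !real_normK ?num_real//.
apply: le_lt_trans yc; rewrite (bigD1 i)//= lerDl sumr_ge0// => j _.
exact: sqr_ge0.
Qed.

Lemma eball_center c r : 0 < r -> eball c r c.
Proof.
by move=> r0; apply/eballP => //; rewrite big1 ?exprn_gt0// => i _; rewrite subrr expr0n.
Qed.

Lemma eball_subset c (r r' : R) : r <= r' -> eball c r `<=` eball c r'.
Proof. by move=> rr' y; rewrite /eball /= => /lt_le_trans; apply. Qed.

(** Follows from the convexity of the square in each coordinate. *)
Lemma eball_convex c r x y (t : R) : 0 <= t <= 1 ->
  eball c r x -> eball c r y -> eball c r (x + t *: (y - x)).
Proof.
move=> /andP[t0 t1] xc yc; have r0 := eball_radius_gt0 xc.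
move: xc yc => /(eballP _ _ r0) xc /(eballP _ _ r0) yc; apply/(eballP _ _ r0).
have [->|tn1] := eqVneq t 1.
  by under eq_bigr do rewrite !mxE mul1r addrC subrK.
apply: (@le_lt_trans _ _ ((1 - t) * (\sum_(i < n) (x ord0 i - c ord0 i) ^+ 2)
    + t * (\sum_(i < n) (y ord0 i - c ord0 i) ^+ 2))).
  rewrite !mulr_sumr -big_split/=; apply: ler_sum => i _; rewrite !mxE.
  set a := x _ _; set b := y _ _; set d := c _ _.
  have : 0 <= t * (1 - t) * (a - b) ^+ 2.
    by rewrite mulr_ge0 ?sqr_ge0// mulr_ge0// subr_ge0.
  by nra.
have -> : r ^+ 2 = (1 - t) * r ^+ 2 + t * r ^+ 2 by ring.
apply: ltr_leD; last by rewrite ler_wpM2l// ltW.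
by rewrite ltr_pM2l// subr_gt0 lt_neqAle tn1.
Qed.

Lemma eball_homothety c r v (t : R) : 0 < t ->
  eball c (t * r) (c + t *: v) <-> eball 0 r v.
Proof.
move=> t0; rewrite /eball /enorm /=.
under eq_bigr do rewrite !mxE addrAC subrr add0r exprMn.
rewrite -mulr_sumr sqrtrM ?sqr_ge0// sqrtr_sqr gtr0_norm// ltr_pM2l//.
by under [in X in _ <-> X]eq_bigr do rewrite !mxE subr0.
Qed.

Lemma eball_translate c r v : eball c r (c + v) <-> eball 0 r v.
Proof.
have := eball_homothety c r v (@ltr01 R).
by rewrite mul1r scale1r.
Qed.

(** A polynomial cannot be large at one point only. Let M be its supremum on the
    ball and x0 a point of the ball where it reaches M / 2. On a segment from x0
    to a point w of the ball it is a univariate polynomial bounded by M, hence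
    has coefficients at most K0 M; a fraction eta of the way to w it has
    therefore moved by at most M / 4. These points x0 + eta (w - x0) fill a ball
    of radius eta r, and eta depends on the degree only, which is what makes the
    later constants independent of the ball without any change of variables.
    The same coefficient bound on segments from the center c, followed beyond
    the ball, gives the control on the tripled ball. *)
Lemma mpoly_concentration s : exists2 K : R, 0 < K & exists2 eta : R, 0 < eta &
  forall p c (r : R), (msize p <= s.+1)%N -> 0 < r ->
  exists M : R, exists z : 'rV[R]_n, [/\ 0 <= M,
    forall y, eball c r y -> `|evalp p y| <= M,
    forall y, eball c (3 * r) y -> `|evalp p y| <= K * M,
    eball z (eta * r) `<=` eball c r &
    forall y, eball z (eta * r) y -> M / 4 <= `|evalp p y|].
Proof.
have [K0 K00 HK0] := @coef_bounded_by_values R s.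
(* Ensures s * K0 * eta <= 1 / 4 and eta <= 1. *)
pose eta := (4 * (s.+1%:R * K0) + 1)^-1.
have dpos : 0 < 4 * (s.+1%:R * K0) + 1 by rewrite addr_gt0// !mulr_gt0.
have eta0 : 0 < eta by rewrite invr_gt0.
have eta1 : eta <= 1 by rewrite invf_le1// lerDr !mulr_ge0// ltW.
exists (s.+1%:R * K0 * 3 ^+ s); first by rewrite !mulr_gt0// exprn_gt0.
exists eta => // p c r sp r0.
pose A := [set `|evalp p y| | y in eball c r].
have [M0 HM0] := evalp_bounded p c (ltW r0).
have ubA : has_ubound A.
  exists M0 => _ [y yc <-]; apply: HM0 => i.
  exact/ltW/eball_coord.
have A0 : A !=set0 by exists `|evalp p c|; exists c => //; exact: eball_center.
pose M := sup A.
have pM y : eball c r y -> `|evalp p y| <= M.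
  by move=> yc; apply: ub_le_sup => //; exists y.
have M_ge0 : 0 <= M by apply: le_trans (pM c (eball_center _ r0)).
have [x0 x0c x0M] : exists2 x0, eball c r x0 & M / 2 <= `|evalp p x0|.
  have [M_gt0|] := ltP 0 M; last first.
    move=> M_le0; exists c; first exact: eball_center.
    by rewrite (le_trans _ (normr_ge0 _))// ler_pdivrMr// mul0r.
  have [_ [y yc <-] My] := sup_adherent (divr_gt0 M_gt0 (@ltr0Sn R 1)) (conj A0 ubA).
  exists y => //; apply: ltW; apply: le_lt_trans My.
  by rewrite -/M [X in _ <= X - _]splitr addrK.
exists M, (x0 + eta *: (c - x0)).
(* The small ball is the image of the given one under the homothety of center
   x0 and ratio eta. *)
have reparam y : eball (x0 + eta *: (c - x0)) (eta * r) y ->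
    exists2 w, eball c r w & y = x0 + eta *: (w - x0).
  move=> yz; exists (c + eta^-1 *: (y - (x0 + eta *: (c - x0)))).
    apply/eball_translate; apply/(eball_homothety (x0 + eta *: (c - x0)) _ _ eta0).
    by rewrite scalerA divff ?gt_eqF// scale1r [X in eball _ _ X]addrC subrK.
  rewrite addrAC scalerDr scalerA divff ?gt_eqF// scale1r.
  by rewrite addrA addrCA subrr addr0.
split => //.
- move=> y yc.
  (* With this parametrization the ball contains the times t < 1 and y is reached
     at t = 3. *)
  have [q [sq qE]] := evalp_line p c (3^-1 *: (y - c)).
  have yE : y = c + 3 *: (3^-1 *: (y - c)).
    by rewrite scalerA divff// scale1r addrC subrK.
  have vr : eball 0 r (3^-1 *: (y - c)).
    apply/(@eball_homothety c _ _ 3) => //.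
    by rewrite -yE.
  have qM t : 0 <= t < 1 -> `|q.[t]| <= M.
    move=> /andP[t0 t1]; rewrite qE; apply: pM.
    have := @eball_convex c r c (c + 3^-1 *: (y - c)) t.
    rewrite [X in t *: X]addrAC subrr add0r; apply.
    + by rewrite t0 ltW.
    + exact: eball_center.
    + exact/eball_translate.
  have cb := HK0 q M (leq_trans sq sp) qM.
  rewrite {1}yE -qE (horner_coef_wide _ (leq_trans sq sp)).
  rewrite (le_trans (ler_norm_sum _ _ _))//.
  apply: (@le_trans _ _ (\sum_(i < s.+1) (K0 * M * 3 ^+ s))).
    apply: ler_sum => i _; rewrite normrM normrX (@ger0_norm _ 3)//.
    by apply: ler_pM; rewrite ?exprn_ge0// ler_weXn2l ?ler1n// -ltnS.
  by rewrite sumr_const card_ord -mulr_natl le_eqVlt; apply/predU1P; left; ring.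
- move=> y /reparam[w wc ->]; apply: eball_convex => //.
  by rewrite ltW.
- move=> y /reparam[w wc ->].
  have [q [sq qE]] := evalp_line p x0 (w - x0).
  have qM t : 0 <= t < 1 -> `|q.[t]| <= M.
    move=> /andP[t0 t1]; rewrite qE; apply: pM; apply: eball_convex => //.
    by rewrite t0 ltW.
  have cb := HK0 q M (leq_trans sq sp) qM.
  have q0 : q`_0 = evalp p x0 by rewrite -horner_coef0 qE scale0r addr0.
  rewrite -qE (horner_coef_wide _ (leq_trans sq sp)) big_ord_recl expr0 mulr1 q0.
  set S := \sum_i _.
  have SM : `|S| <= M / 4.
    rewrite (le_trans (ler_norm_sum _ _ _))//.
    apply: (@le_trans _ _ (\sum_(i < s) (K0 * M * eta))).
      apply: ler_sum => i _; rewrite normrM normrX (gtr0_norm eta0).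
      apply: ler_pM; rewrite ?exprn_ge0 ?(ltW eta0)// lift0 exprS.
      by rewrite ler_piMr ?(ltW eta0)// exprn_ile1// ltW.
    rewrite sumr_const card_ord -mulr_natl.
    apply: (@le_trans _ _ (M * (s.+1%:R * K0) * eta)).
      have : 0 <= K0 * M * eta by rewrite mulr_ge0 ?(ltW eta0)// mulr_ge0// ltW.
      by rewrite -natr1; lra.
    rewrite /eta ler_pdivrMr//.
    by nra.
  have := ler_normB (evalp p x0 + S) S.
  rewrite addrK => h; lra.
Qed.

End mpoly_lines.

(** * Lebesgue measure and integrability on balls *)

Section measure_rV.
Context {R : realType} {n : nat}.
Implicit Types (A : set 'rV[R]_n) (c : 'rV[R]_n) (r : R).
Local Notation mu := (@lebesgue_rV R n).

Lemma measurable_borel_lebesgue A :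
  measurable A -> measurable (A : set (lebesgueType R n)).
Proof. exact: caratheodory_measurable_mu_ext. Qed.

Lemma lebesgue_rVE A : measurable A -> mu A = lebesgue_borel_rV R n A.
Proof. exact: measurable_mu_extE. Qed.

Lemma measurable_coord_lebesgue (i : 'I_n) :
  measurable_fun setT (fun x : lebesgueType R n => (x : 'rV[R]_n) ord0 i).
Proof.
move=> _ Y mY; apply: measurable_borel_lebesgue.
exact: measurable_coord_rV.
Qed.

Lemma ballE_rV c r : 0 < r ->
  ball c r = [set x : 'rV[R]_n | forall i, `|c ord0 i - x ord0 i| < r].
Proof.
move=> r0; apply/seteqP; split=> x /=.
  by move=> [_ H] i; exact: (H ord0 i).
by move=> H; split=> // i j; rewrite [i]ord1; exact: H.
Qed.

Lemma measurable_ball_rV c r : measurable (ball c r).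
Proof.
have [r0|r0] := ltP 0 r; last first.
  rewrite (_ : ball c r = set0)//; apply/seteqP; split=> x //= [].
  by rewrite ltNge r0.
rewrite ballE_rV//.
rewrite (_ : mkset _ = \bigcap_(i in [set: 'I_n]) [set x : 'rV[R]_n | `|c ord0 i - x ord0 i| < r]).
  apply: fin_bigcap_measurable => [|i _]; first exact: finite_finset.
  rewrite -[X in measurable X]setTI.
  pose D := [set t : R | `|c ord0 i - t| < r].
  apply: (@measurable_coord_rV R n i measurableT D).
  by rewrite (_ : D = ball (c ord0 i) r) // ball_itv; exact: measurable_itv.
by apply/seteqP; split=> x /= h i; [move=> _; exact: h|exact: h].
Qed.

End measure_rV.

(** Balls of the sup norm are cubes, so their volume follows from the product
    construction of the measure. The volume of Euclidean balls
    is estimated by comparison with cubes. *)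
Lemma lebesgue_borel_ball (R : realType) n (c : 'rV[R]_n) (r : R) : 0 < r ->
  lebesgue_borel_rV R n (ball c r) = ((2 * r) ^+ n)%:E.
Proof.
move=> r0; elim: n c => [|n IH] c.
  rewrite /= diracE mem_set// ballE_rV//= => -[]//.
rewrite /= /lebesgue_cons /pushforward.
pose t := c ord0 ord0; pose d : 'rV[R]_n := \row_j c ord0 (lift ord0 j).
rewrite (_ : _ @^-1` _ = ball t r `*` ball d r); last first.
  have E0 x y : @rV_cons R n (x, y) ord0 ord0 = x.
    by rewrite mxE; case: splitP => // j _; rewrite mxE !ord1 eqxx mulr1n.
  have E1 x y j : @rV_cons R n (x, y) ord0 (lift ord0 j) = y ord0 j.
    rewrite -[RHS](row_mxEr (x : R)%:M y ord0 j).
    by congr (row_mx _ _ _ _); exact: val_inj.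
  rewrite !ballE_rV//; apply/seteqP; split=> -[x y] /=.
    move=> h; split; first by have := h ord0; rewrite E0.
    by move=> i; have := h (lift ord0 i); rewrite E1 mxE.
  move=> [hx hy] i; have [->|ij] := eqVneq i ord0; first by rewrite E0.
  have [j ->] : exists j, i = lift ord0 j.
    by have [j k|] := unliftP ord0 i; [exists j|move=> i0; rewrite i0 eqxx in ij].
  by have := hy j; rewrite E1 mxE.
rewrite product_measure1E.
- rewrite IH exprS EFinM; congr (_ * _)%E.
  by rewrite /= lebesgue_measure_ball ?ltW// mulr_natl.
- by rewrite ball_itv; exact: measurable_itv.
- exact: measurable_ball_rV.
Qed.

Section integrability_rV.
Context {R : realType} {n : nat}.
Implicit Types (f : 'rV[R]_n -> R) (A B : set 'rV[R]_n) (c x y : 'rV[R]_n) (r : R).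
Local Notation mu := (@lebesgue_rV R n).
Local Notation T := (lebesgueType R n).

Lemma lebesgue_ball c r : 0 < r -> mu (ball c r) = ((2 * r) ^+ n)%:E.
Proof.
move=> r0; rewrite lebesgue_rVE; last exact: measurable_ball_rV.
exact: lebesgue_borel_ball.
Qed.

Lemma measurable_lebesgue_ball c r : measurable (ball c r : set T).
Proof. by apply: measurable_borel_lebesgue; exact: measurable_ball_rV. Qed.

Lemma measurable_evalp (p : mpoly n R) :
  measurable_fun setT (fun x : T => evalp p (x : 'rV[R]_n)).
Proof.
under eq_fun do rewrite /evalp mevalE.
apply: measurable_sum => m; apply: measurable_funM.
  exact: measurable_cst.
apply: measurable_prod => i _; apply: measurable_funX.
exact: measurable_coord_lebesgue.
Qed.

Lemma measurable_eball c r : measurable (eball c r : set T).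
Proof.
have [r0|r0] := ltP 0 r; last first.
  rewrite (_ : eball c r = set0)//; apply/seteqP; split=> x // /eball_radius_gt0.
  by rewrite ltNge r0.
pose F (x : T) := \sum_(i < n) ((x : 'rV[R]_n) ord0 i - c ord0 i) ^+ 2.
have mF : measurable_fun setT F.
  apply: measurable_sum => i; apply: measurable_funX; apply: measurable_funB.
    exact: measurable_coord_lebesgue.
  exact: measurable_cst.
rewrite (_ : eball c r = setT `&` F @^-1` `]-oo, r ^+ 2[%classic); first exact: mF.
rewrite setTI; apply/seteqP; split=> y /=; rewrite in_itv/=.
  by move/(eballP _ _ r0).
by move=> H; apply/(eballP _ _ r0).
Qed.

Lemma eball_sub_ball c r : eball c r `<=` ball c r.
Proof.
move=> y yc; have r0 := eball_radius_gt0 yc.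
by rewrite ballE_rV// => i; rewrite distrC; exact: eball_coord.
Qed.

Lemma ball_sub_eball c r : (0 < n)%N -> 0 < r -> ball c (r / n%:R) `<=` eball c r.
Proof.
move=> n0 r0 y; have n0' : 0 < n%:R :> R by rewrite ltr0n.
have rn0 : 0 < r / n%:R by rewrite divr_gt0.
rewrite ballE_rV// => /= yc; apply/(eballP _ _ r0).
apply: (@lt_le_trans _ _ (\sum_(i < n) (r / n%:R) ^+ 2)).
  apply: ltr_sum; first by apply/hasP; exists (Ordinal n0); rewrite ?mem_index_enum.
  move=> i _; rewrite -real_normK ?num_real// distrC.
  by rewrite ltrXn2r// nnegrE ltW.
rewrite sumr_const card_ord -[_ *+ n]mulr_natl.
apply: (@le_trans _ _ (n%:R * (n%:R * (r / n%:R) ^+ 2))).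
  by rewrite ler_peMl ?ler1n// mulr_ge0 ?ler0n// sqr_ge0.
by rewrite mulrA -expr2 -exprMn mulrC divfK ?gt_eqF.
Qed.

Lemma L1loc_integrable_ball f c r : L1loc f -> mu.-integrable (ball c r) (EFin \o f).
Proof.
move=> [mf fK].
have [r0|r0] := ltP 0 r; last first.
  rewrite (_ : ball c r = set0); first exact: integrable_set0.
  by apply/seteqP; split=> x //= []; rewrite ltNge r0.
pose Q := [set v : 'rV[R]_n | forall i, `[c ord0 i - r, c ord0 i + r]%classic (v ord0 i)].
have cQ : compact Q.
  apply: (@rV_compact R n (fun i => `[c ord0 i - r, c ord0 i + r]%classic)) => i.
  exact: segment_compact.
have mQ : measurable (Q : set T).
  rewrite (_ : Q = \bigcap_(i in [set: 'I_n])
      [set v : 'rV[R]_n | `[c ord0 i - r, c ord0 i + r]%classic (v ord0 i)]).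
    apply: fin_bigcap_measurable => [|i _]; first exact: finite_finset.
    rewrite -[X in measurable X]setTI.
    apply: (measurable_coord_lebesgue i measurableT).
    exact: measurable_itv.
  by apply/seteqP; split=> x /= h i; [move=> _; exact: h|exact: h].
have iQ : mu.-integrable Q (EFin \o f).
  apply/integrableP; split; first by apply/measurable_EFinP; exact: measurable_funTS.
  exact: fK.
apply: integrableS iQ => //; first exact: measurable_lebesgue_ball.
rewrite ballE_rV// => x xc i.
by rewrite /= in_itv/= -ler_distl distrC; exact/ltW/xc.
Qed.

Lemma L1loc_integrable_eball f c r : L1loc f -> mu.-integrable (eball c r) (EFin \o f).
Proof.
move=> f1; have := @L1loc_integrable_ball f c r f1; apply: integrableS.
- exact: measurable_lebesgue_ball.
- exact: measurable_eball.
- exact: eball_sub_ball.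
Qed.

Lemma evalp_bounded_on_eball (p : mpoly n R) c r :
  [bounded evalp p x | x in eball c r].
Proof.
have [M HM] := evalp_bounded p c (normr_ge0 r).
exists M; split => [|t Mt x xc]; first exact: num_real.
apply: le_trans (ltW Mt); apply: HM => i.
by rewrite (le_trans (ltW (eball_coord i xc)))// ler_norm.
Qed.

Lemma integrable_mul_evalp f (p : mpoly n R) c r :
  mu.-integrable (eball c r) (EFin \o f) ->
  mu.-integrable (eball c r) (EFin \o (fun x => f x * evalp p x)).
Proof.
move=> fi; have := integrableMl _ fi _ (evalp_bounded_on_eball p c r).
apply.
  exact: measurable_eball.
by apply: measurable_funTS; exact: measurable_evalp.
Qed.

Lemma lebesgue_eball_lty c r : (mu (eball c r) < +oo)%E.
Proof.
have [r0|r0] := ltP 0 r; last first.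
  rewrite (_ : eball c r = set0) ?measure0//; apply/seteqP; split=> x // /eball_radius_gt0.
  by rewrite ltNge r0.
apply: (@le_lt_trans _ _ (mu (ball c r))).
  apply: le_measure; rewrite ?inE; [exact: measurable_eball|exact: measurable_lebesgue_ball|].
  exact: eball_sub_ball.
by rewrite lebesgue_ball// ltry.
Qed.

Lemma integrable_evalp (p : mpoly n R) c r :
  mu.-integrable (eball c r) (EFin \o evalp p).
Proof.
apply: (@measurable_bounded_integrable _ T R mu (evalp p)).
- exact: measurable_eball.
- exact: lebesgue_eball_lty.
- by apply: measurable_funTS; exact: measurable_evalp.
- exact: evalp_bounded_on_eball.
Qed.

(** The real-valued volume; balls have finite measure, so nothing is lost there. *)
Definition vol A : R := fine (mu A).

Lemma volE c r : mu (eball c r) = (vol (eball c r))%:E.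
Proof.
by rewrite /vol fineK// ge0_fin_numE ?lebesgue_eball_lty//; exact: measure_ge0.
Qed.

Lemma vol_eball_le c r : 0 < r -> vol (eball c r) <= (2 * r) ^+ n.
Proof.
move=> r0; rewrite -lee_fin -volE -(@lebesgue_ball c)//.
apply: le_measure; rewrite ?inE; [exact: measurable_eball|exact: measurable_lebesgue_ball|].
exact: eball_sub_ball.
Qed.

Lemma vol_eball_ge c r : (0 < n)%N -> 0 < r -> (2 * r / n%:R) ^+ n <= vol (eball c r).
Proof.
move=> n0 r0; rewrite -lee_fin -volE -mulrA -(@lebesgue_ball c) ?divr_gt0 ?ltr0n//.
apply: le_measure; rewrite ?inE; [exact: measurable_lebesgue_ball|exact: measurable_eball|].
exact: ball_sub_eball.
Qed.

Lemma vol_eball_gt0 c r : (0 < n)%N -> 0 < r -> 0 < vol (eball c r).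
Proof.
move=> n0 r0; apply: lt_le_trans (vol_eball_ge c n0 r0).
by rewrite exprn_gt0// divr_gt0 ?mulr_gt0 ?ltr0n.
Qed.

(** The real-valued counterpart of avg. *)
Definition ravg f B : R :=
  (\int[mu]_(y in B) `|f y|) / vol B.

Lemma ravg_ge0 f B : 0 <= ravg f B.
Proof. by rewrite divr_ge0 ?Rintegral_ge0// /vol fine_ge0// measure_ge0. Qed.

End integrability_rV.

(** * Polynomial projections on balls *)

Lemma Rintegral_sum d (T : measurableType d) (R : realType)
    (mu : {measure set T -> \bar R}) (D : set T) (I : Type) (l : seq I)
    (F : I -> T -> R) :
  measurable D -> (forall i, mu.-integrable D (EFin \o F i)) ->
  \int[mu]_(x in D) (\sum_(i <- l) F i x) = \sum_(i <- l) \int[mu]_(x in D) F i x.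
Proof.
move=> mD Fi.
have iS l' : mu.-integrable D (EFin \o (fun x => \sum_(i <- l') F i x)).
  have := integrable_sum mD l' (P := xpredT) (h := fun i => EFin \o F i)
    (fun i _ => Fi i).
  by apply: eq_integrable => // x _ /=; rewrite sumEFin.
elim: l => [|i l IH].
  rewrite big_nil; under eq_Rintegral do rewrite big_nil.
  by rewrite Rintegral_cst// mul0r.
rewrite big_cons -IH -RintegralD//.
by under eq_Rintegral do rewrite big_cons.
Qed.

Section projection.
Context {R : realType} {n : nat} (n_gt0 : (0 < n)%N) (s : nat).
Implicit Types (f : 'rV[R]_n -> R) (p q h : mpoly n R) (c x y : 'rV[R]_n) (r : R).
Local Notation mu := (@lebesgue_rV R n).
Local Notation T := (lebesgueType R n).

(** On the small ball given by [mpoly_concentration] the square of the polynomial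
    is at least (M / 4)^2, and this ball has a fixed proportion of the volume of
    the whole ball, up to the ratio between cubes and Euclidean balls. *)
Lemma sup_mpoly_le_L2 : exists2 K : R, 0 < K & exists2 kappa : R, 0 < kappa &
  forall p c r, (msize p <= s.+1)%N -> 0 < r -> exists M : R, [/\ 0 <= M,
    forall y, eball c r y -> `|evalp p y| <= M,
    forall y, eball c (3 * r) y -> `|evalp p y| <= K * M &
    kappa * M ^+ 2 * vol (eball c r) <= \int[mu]_(x in eball c r) evalp (p * p) x].
Proof.
have [K K0 [eta eta0 H]] := @mpoly_concentration R n s.
exists K => //; exists (16^-1 * (eta / n%:R) ^+ n).
  by rewrite mulr_gt0// exprn_gt0// divr_gt0// ltr0n.
move=> p c r sp r0; have [M [z [M0 pM p3M zc Mp]]] := H p c r sp r0.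
exists M; split => //.
have ppE x : evalp (p * p) x = evalp p x ^+ 2 by rewrite /evalp mevalM expr2.
have er0 : 0 < eta * r by rewrite mulr_gt0.
apply: (@le_trans _ _ ((M / 4) ^+ 2 * vol (eball z (eta * r)))).
  apply: (@le_trans _ _ ((M / 4) ^+ 2 * ((2 * (eta * r) / n%:R) ^+ n))); last first.
    by rewrite ler_wpM2l ?sqr_ge0// vol_eball_ge.
  have -> : 2 * (eta * r) / n%:R = (eta / n%:R) * (2 * r) by ring.
  rewrite [(_ * (2 * r)) ^+ n]exprMn.
  have -> : (M / 4) ^+ 2 = 16^-1 * M ^+ 2 by field.
  have -> : 16^-1 * (eta / n%:R) ^+ n * M ^+ 2 * vol (eball c r) =
    16^-1 * M ^+ 2 * ((eta / n%:R) ^+ n * vol (eball c r)) by ring.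
  rewrite ler_wpM2l ?mulr_ge0 ?sqr_ge0// ler_wpM2l ?vol_eball_le//.
  by rewrite exprn_ge0// divr_ge0 ?ler0n// ltW.
have i1 := @integrable_evalp R n (p * p) c r.
have i2 := @integrable_evalp R n (p * p) z (eta * r).
rewrite -lee_fin EFinM -volE.
rewrite [leRHS]fineK; last by apply: (integrable_fin_num _ i1); exact: measurable_eball.
rewrite -integral_cst; last exact: measurable_eball.
apply: (@le_trans _ _ (\int[mu]_(x in eball z (eta * r)) (evalp (p * p) x)%:E)%E).
  apply: (ge0_le_integral mu (measurable_eball _ _)).
  - by move=> x _; rewrite lee_fin sqr_ge0.
  - exact: measurable_cst.
  - by case/integrableP : i2.
  - move=> x xz; rewrite lee_fin ppE -[leRHS]real_normK ?num_real//.
    by rewrite lerXn2r ?nnegrE ?divr_ge0// Mp.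
apply: (ge0_subset_integral mu (measurable_eball _ _) (measurable_eball _ _) _ _ zc).
- by case/integrableP : i1.
- by move=> x _; rewrite lee_fin ppE sqr_ge0.
Qed.

Lemma evalp_mpolyX (a : multinom n) x :
  evalp (mpolyX R a) x = \prod_(i < n) x ord0 i ^+ a i.
Proof. exact: mevalX. Qed.

Lemma integrable_sub_evalp f p c r : mu.-integrable (eball c r) (EFin \o f) ->
  mu.-integrable (eball c r) (EFin \o (fun x => f x - evalp p x)).
Proof.
move=> fi; have mB := @measurable_eball R n c r.
have := integrableB mB fi (integrable_evalp p c r).
by apply: eq_integrable.
Qed.

Lemma mproj_orthogonal f p h c r : mu.-integrable (eball c r) (EFin \o f) ->
  is_mproj s f (eball c r) p -> (msize h <= s.+1)%N ->
  \int[mu]_(x in eball c r) ((f x - evalp p x) * evalp h x) = 0.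
Proof.
move=> fi [_ Hp] sh; have mB := @measurable_eball R n c r.
have fpi := integrable_sub_evalp p fi.
have ai (a : multinom n) : mu.-integrable (eball c r)
    (EFin \o (fun x => (f x - evalp p x) * \prod_(i < n) x ord0 i ^+ a i)).
  have := integrable_mul_evalp (mpolyX R a) fpi.
  by apply: eq_integrable => // x _; rewrite /= evalp_mpolyX.
transitivity (\int[mu]_(x in eball c r) \sum_(a <- msupp h)
    mcoeff a h * ((f x - evalp p x) * \prod_(i < n) x ord0 i ^+ a i)).
  apply: eq_Rintegral => x _; rewrite [evalp h x]mevalE mulr_sumr.
  by apply: eq_bigr => a _; rewrite mulrCA.
rewrite Rintegral_sum//; last first.
  move=> a; have := integrableZl mB (mcoeff a h) (ai a).
  by apply: eq_integrable.
rewrite big_seq big1// => a ah.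
rewrite RintegralZl//.
by rewrite /Rintegral Hp ?mulr0// -ltnS (leq_trans (msize_mdeg_lt ah)).
Qed.

(** The polynomial h = p - q is the projection of f - q, whence
    int h^2 = int (f - q) h, which is at most sup |h| times int |f - q|.
    Comparing with the lower bound of int h^2 by sup |h|^2 from
    [sup_mpoly_le_L2], one factor sup |h| cancels. *)
Lemma mproj_sub_le : exists2 C : R, 0 < C &
  forall f p q c r, 0 < r -> mu.-integrable (eball c r) (EFin \o f) ->
    is_mproj s f (eball c r) p -> (msize q <= s.+1)%N ->
    forall x, eball c (3 * r) x ->
    `|evalp p x - evalp q x| <=
      C * ravg (fun y => f y - evalp q y) (eball c r).
Proof.
have [K K0 [kappa kappa0 H]] := sup_mpoly_le_L2.
exists (K / kappa); first by rewrite divr_gt0.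
move=> f p q c r r0 fi Pp sq x xc; have mB := @measurable_eball R n c r.
have sh : (msize (p - q) <= s.+1)%N.
  have [sp _] := Pp.
  by rewrite (leq_trans (msizeD_le _ _))// geq_max sp msizeN.
have [M [M0 hM h3M L2]] := H (p - q) c r sh r0.
have V0 := vol_eball_gt0 c n_gt0 r0.
rewrite /ravg; set I := \int[mu]_(y in _) _.
have I0 : 0 <= I by apply: Rintegral_ge0.
have fqi := integrable_sub_evalp q fi.
have fpi := integrable_sub_evalp p fi.
have hE y : evalp (p - q) y = evalp p y - evalp q y by rewrite evalpB.
have L2I : \int[mu]_(y in eball c r) evalp ((p - q) * (p - q)) y <= M * I.
  (* f - q = (f - p) + (p - q), where f - p is orthogonal to p - q. *)
  have -> : \int[mu]_(y in eball c r) evalp ((p - q) * (p - q)) y =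
      \int[mu]_(y in eball c r) ((f y - evalp q y) * evalp (p - q) y).
    transitivity (\int[mu]_(y in eball c r) ((f y - evalp p y) * evalp (p - q) y
        + evalp ((p - q) * (p - q)) y)).
      rewrite RintegralD//; last 2 first.
      - exact: integrable_mul_evalp.
      - exact: integrable_evalp.
      by rewrite mproj_orthogonal// add0r.
    apply: eq_Rintegral => y _; rewrite /evalp mevalM -mulrDl; congr (_ * _).
    by rewrite mevalB addrA subrK.
  rewrite -RintegralZl//; last by apply: integrable_norm.
  apply: le_Rintegral => //.
  - exact: integrable_mul_evalp.
  - have := integrableZl mB M (integrable_norm fqi).
    by apply: eq_integrable.
  move=> y yc; rewrite (le_trans (ler_norm _))// normrM mulrC.
  by rewrite ler_wpM2r// hM.
rewrite -hE (le_trans (h3M _ xc))//.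
rewrite -mulrA ler_wpM2l ?(ltW K0)//.
have [->|Mn0] := eqVneq M 0.
  by rewrite mulr_ge0 ?invr_ge0 ?divr_ge0// ltW.
have Mp : 0 < M by rewrite lt_neqAle eq_sym Mn0.
rewrite mulrC -mulrA -invfM ler_pdivlMr ?mulr_gt0// -(ler_pM2l Mp).
by apply: le_trans L2I; apply: le_trans L2; rewrite le_eqVlt; apply/predU1P; left; ring.
Qed.

(** The coefficients of the projection solve a linear system whose matrix G is the
    Gram matrix of the monomials of degree at most s. Rather than inverting G,
    it is enough that the right-hand side b is orthogonal to the kernel of G: a
    kernel vector w is the coefficient vector of a polynomial P w with
    int (P w)^2 = 0, so P w vanishes on the ball and b . w = int f (P w) = 0. *)
Lemma mproj_exists f c r : 0 < r -> mu.-integrable (eball c r) (EFin \o f) ->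
  exists p, is_mproj s f (eball c r) p.
Proof.
move=> r0 fi; have mB := @measurable_eball R n c r.
have [K K0 [kappa kappa0 H]] := sup_mpoly_le_L2.
pose B := eball c r.
pose N := #|{: bmultinom n s.+1}|.
pose e (i : 'I_N) : mpoly n R := mpolyX R (enum_val i : bmultinom n s.+1).
pose P (w : 'I_N -> R) : mpoly n R := \sum_i w i *: e i.
have sP w : (msize (P w) <= s.+1)%N.
  rewrite /P; elim/big_ind : _ => [|a b sa sb|i _]; first by rewrite msize0.
    by rewrite (leq_trans (msizeD_le _ _))// geq_max sa.
  by rewrite (leq_trans (msizeZ_le _ _))// msizeX ltnS -ltnS bmdeg.
have PE w x : evalp (P w) x = \sum_i w i * evalp (e i) x.
  rewrite /evalp raddf_sum/=; apply: eq_bigr => i _; exact: mevalZ.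
have PI w g : mu.-integrable B (EFin \o g) ->
    \int[mu]_(x in B) (g x * evalp (P w) x) =
    \sum_i w i * \int[mu]_(x in B) (g x * evalp (e i) x).
  move=> gi.
  transitivity (\int[mu]_(x in B) \sum_i w i * (g x * evalp (e i) x)).
    apply: eq_Rintegral => x _; rewrite PE mulr_sumr.
    by apply: eq_bigr => i _; rewrite mulrCA.
  rewrite Rintegral_sum//; last first.
    move=> i; have := integrableZl mB (w i) (integrable_mul_evalp (e i) gi).
    by apply: eq_integrable.
  apply: eq_bigr => i _; rewrite RintegralZl//; exact: integrable_mul_evalp.
pose G : 'M[R]_N := \matrix_(i, j) \int[mu]_(x in B) (evalp (e i) x * evalp (e j) x).
pose b : 'rV[R]_N := \row_j \int[mu]_(x in B) (f x * evalp (e j) x).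
have : (b <= G)%MS.
  rewrite submxE; apply/eqP/rowP => k; rewrite !mxE.
  pose w i := cokermx G i k.
  have Gw i : \int[mu]_(x in B) (evalp (e i) x * evalp (P w) x) = 0.
    rewrite PI; last exact: integrable_evalp.
    transitivity ((G *m cokermx G) i k); last by rewrite mulmx_coker mxE.
    by rewrite mxE; apply: eq_bigr => j _; rewrite [G i j]mxE mulrC.
  have PP0 : \int[mu]_(x in B) evalp (P w * P w) x = 0.
    transitivity (\int[mu]_(x in B) (evalp (P w) x * evalp (P w) x)).
      by apply: eq_Rintegral => x _; rewrite /evalp mevalM.
    rewrite PI; last exact: integrable_evalp.
    apply: big1 => i _; rewrite -[RHS](mulr0 (w i)) -(Gw i); congr (_ * _).
    by apply: eq_Rintegral => x _; rewrite mulrC.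
  have [M [M0 pM _ L2]] := H (P w) c r (sP w) r0.
  have M00 : M = 0.
    apply/eqP; rewrite eq_le M0 andbT leNgt; apply/negP => Mp.
    by move: L2; rewrite PP0 leNgt !mulr_gt0 ?exprn_gt0// vol_eball_gt0.
  transitivity (\int[mu]_(x in B) (f x * evalp (P w) x)).
    by rewrite PI//; apply: eq_bigr => i _; rewrite [b 0 i]mxE mulrC.
  transitivity (\int[mu]_(x in B) (cst 0 x : R)).
    apply: eq_Rintegral => x; rewrite inE => /pM.
    by rewrite M00 normr_le0 => /eqP ->; rewrite mulr0.
  by rewrite Rintegral_cst ?mul0r.
move=> /submxP[v bE].
exists (P (v ord0)); split => // a sa.
have [i ei] : exists i : 'I_N, e i = mpolyX R a.
  have ba : (mdeg a < s.+1)%N by rewrite ltnS.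
  by exists (enum_rank (BMultinom ba)); rewrite /e enum_rankK.
have fPi := integrable_sub_evalp (P (v ord0)) fi.
have iE : mu.-integrable (eball c r)
    (EFin \o (fun x => (f x - evalp (P (v ord0)) x) * evalp (e i) x)).
  exact: integrable_mul_evalp.
transitivity (\int[mu]_(x in B) ((f x - evalp (P (v ord0)) x) * evalp (e i) x)%:E)%E.
  by apply: eq_integral => x _; rewrite ei evalp_mpolyX.
rewrite -[LHS]fineK; last exact: (integrable_fin_num mB iE).
congr (_%:E); rewrite -/(Rintegral _ _ _).
transitivity (\int[mu]_(x in B) (f x * evalp (e i) x - evalp (e i) x * evalp (P (v ord0)) x)).
  by apply: eq_Rintegral => x _; rewrite mulrBl [X in _ - X]mulrC.
rewrite RintegralB//; last 2 first.
- exact: integrable_mul_evalp.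
- by apply: integrable_mul_evalp; exact: integrable_evalp.
apply/eqP; rewrite subr_eq0; apply/eqP.
have /rowP/(_ i) := bE; rewrite !mxE => ->.
rewrite PI; last exact: integrable_evalp.
apply: eq_bigr => j _; rewrite mxE; congr (_ * _).
by apply: eq_Rintegral => x _; rewrite mulrC.
Qed.

Lemma mproj_is_mproj f c r : 0 < r -> mu.-integrable (eball c r) (EFin \o f) ->
  is_mproj s f (eball c r) (mproj s f (eball c r)).
Proof. by move=> r0 fi; apply: xgetPex; exact: mproj_exists. Qed.

End projection.

(** * Outer regularity of Lebesgue measure *)

Section outer_regularity.
Context {R : realType} {n : nat}.
Local Open Scope ereal_scope.

Section borel.
Variables (m : {measure set 'rV[R]_n -> \bar R}) (D : set 'rV[R]_n).
Hypotheses (mD : measurable D) (Dfin : m D < +oo).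

(** Approximation of both A and its complement from outside, up to a small
    overlap inside D. Equivalently A lies between a closed and an open set whose
    difference is small; this form is symmetric under complement. *)
Definition separable_by_open (A : set 'rV[R]_n) :=
  measurable A /\ forall e : R, (0 < e)%R -> exists U V : set 'rV[R]_n,
    [/\ open U /\ measurable U, open V /\ measurable V, A `<=` U, ~` A `<=` V &
        m (D `&` (U `&` V)) < e%:E].

Lemma separable_by_openC A : separable_by_open A -> separable_by_open (~` A).
Proof.
move=> [mA H]; split=> [|e e0]; first exact: measurableC.
have [U [V [oU oV AU AV UV]]] := H e e0.
by exists V, U; split => //; [rewrite setCK|rewrite (setIC V)].
Qed.

(** Continuity from above, in the form used to stop an infinite intersection at
    a finite stage. *)
Lemma nonincreasing_small (F : (set 'rV[R]_n)^nat) (e : R) :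
  (forall k, measurable (F k)) -> nonincreasing_seq F -> m (F 0%N) < +oo ->
  m (\bigcap_k F k) < e%:E -> exists k, m (F k) < e%:E.
Proof.
move=> mF ndF F0 Fe.
have mcap : measurable (\bigcap_k F k) by exact: bigcapT_measurable.
have F0fin k : m (F k) \is a fin_num.
  rewrite ge0_fin_numE ?measure_ge0//; apply: le_lt_trans F0.
  by apply: le_measure; rewrite ?inE//; exact/subsetPset/ndF.
have capfin : m (\bigcap_k F k) \is a fin_num.
  by rewrite ge0_fin_numE ?measure_ge0//; apply: lt_trans Fe (ltry _).
have := nonincreasing_cvg_mu F0 mF mcap ndF.
rewrite -(fineK capfin) => /fine_cvg /cvgrPdist_lt.
have eF : (0 < e - fine (m (\bigcap_k F k)))%R.
  by rewrite subr_gt0 -lte_fin fineK.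
move=> /(_ _ eF)[k _ /(_ k (leqnn k))] /= H.
exists k; rewrite -(fineK (F0fin k)) lte_fin.
by move: H; rewrite ltr_distl => /andP[+ _]; rewrite ltrBlDr addrC subrK.
Qed.

(** The open sets around the A k may be united, but those around their
    complements may only be intersected finitely many times; finiteness of m on D
    allows to stop at a stage N where little mass remains. *)
Lemma separable_by_open_bigcup (A : (set 'rV[R]_n)^nat) :
  (forall k, separable_by_open (A k)) -> separable_by_open (\bigcup_k A k).
Proof.
move=> H; split=> [|e e0]; first by apply: bigcupT_measurable => k; case: (H k).
have ek k : (0 < e / 2 / (2 ^ k.+1)%:R)%R.
  by rewrite !divr_gt0// ltr0n expn_gt0.
have /choice[UV HUV] : forall k, exists UV : set 'rV[R]_n * set 'rV[R]_n,
    [/\ open UV.1 /\ measurable UV.1, open UV.2 /\ measurable UV.2,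
      A k `<=` UV.1, ~` A k `<=` UV.2 &
      m (D `&` (UV.1 `&` UV.2)) < (e / 2 / (2 ^ k.+1)%:R)%:E].
  by move=> k; have [_ /(_ _ (ek k))[U [V ?]]] := H k; exists (U, V).
pose U := \bigcup_k (UV k).1.
pose V N := \big[setI/setT]_(k < N) (UV k).2.
have VE N : V N = \bigcap_(k < N) (UV k).2.
  by rewrite (bigcap_mkord N (fun k => (UV k).2)).
have oV N : open (V N) /\ measurable (V N).
  rewrite /V; elim/big_ind : _ => [|X Y [oX mX] [oY mY]|k _].
  - by split; [exact: openT|exact: measurableT].
  - by split; [exact: openI|exact: measurableI].
  - by case: (HUV k).
have mU : measurable U by apply: bigcupT_measurable => k; case: (HUV k) => -[].
pose F N := D `&` (U `&` V N).
have mF N : measurable (F N).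
  by apply: measurableI => //; apply: measurableI => //; case: (oV N).
have [N FN] : exists N, m (F N) < e%:E.
  apply: nonincreasing_small => //.
  - move=> N M NM; apply/subsetPset; apply: setIS; apply: setIS => x.
    rewrite !VE => h i /= iN; apply: h => /=.
    exact: leq_trans NM.
  - apply: le_lt_trans Dfin; apply: le_measure; rewrite ?inE//.
    exact: subIsetl.
  - apply: (@le_lt_trans _ _ (\sum_(k <oo) m (D `&` ((UV k).1 `&` (UV k).2)))).
      apply: measure_sigma_subadditive.
      - move=> k; apply: measurableI => //; apply: measurableI.
        + by case: (HUV k) => -[].
        + by case: (HUV k) => _ [].
      - exact: bigcapT_measurable.
      - move=> x FNx; have [Dx [[k _ Ukx] _]] := FNx 0%N I.
        exists k => //; split=> //; split=> //.
        have [_ [_]] := FNx k.+1 I.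
        by rewrite VE => /(_ k); apply => /=.
    apply: (@le_lt_trans _ _ (e / 2)%:E); last first.
      by rewrite lte_fin ltr_pdivrMr// mulr2n mulrDr mulr1 ltrDl.
    apply: le_trans (epsilon_trick0 xpredT (ltW (divr_gt0 e0 (@ltr0Sn R 1)))).
    apply: lee_nneseries => // k _; apply: ltW.
    by case: (HUV k).
exists U, (V N); split => //.
- by split => //; apply: bigcup_open => k _; case: (HUV k) => -[].
- move=> x [k _ Akx]; exists k => //; case: (HUV k) => _ _ + _ _; exact.
- move=> x nAx; rewrite VE => k _.
  by case: (HUV k) => _ _ _ + _; apply => Akx; apply: nAx; exists k.
Qed.

Lemma separable_by_open0 : separable_by_open set0.
Proof.
split=> // e e0; exists set0, setT; split => //.
- by split; [exact: open0|].
- by split; [exact: openT|].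
- by rewrite set0I setI0 measure0 lte_fin.
Qed.

(** An open half-space is its own outer approximation, and its complement is
    the decreasing limit of the half-spaces with bound a + 1 / (k + 1). *)
Lemma separable_by_open_halfspace (i : 'I_n) (a : R) :
  separable_by_open [set x : 'rV[R]_n | (a < x ord0 i)%R].
Proof.
have mlt b : measurable [set x : 'rV[R]_n | (b < x ord0 i)%R].
  rewrite -[X in measurable X]setTI.
  rewrite (_ : mkset _ = (fun x : 'rV[R]_n => x ord0 i) @^-1` `]b, +oo[%classic).
    by apply: (@measurable_coord_rV R n i measurableT); exact: measurable_itv.
  by apply/seteqP; split=> x /=; rewrite in_itv/= andbT.
have mgt b : measurable [set x : 'rV[R]_n | (x ord0 i < b)%R].
  rewrite -[X in measurable X]setTI.
  rewrite (_ : mkset _ = (fun x : 'rV[R]_n => x ord0 i) @^-1` `]-oo, b[%classic).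
    by apply: (@measurable_coord_rV R n i measurableT); exact: measurable_itv.
  by apply/seteqP; split=> x /=; rewrite in_itv/=.
split=> // e e0.
pose U := [set x : 'rV[R]_n | (a < x ord0 i)%R].
pose V k := [set x : 'rV[R]_n | (x ord0 i < a + k.+1%:R^-1)%R].
have mF k : measurable (D `&` (U `&` V k)).
  apply: measurableI mD _; apply: measurableI; [exact: mlt|exact: mgt].
have [k Fk] : exists k, m (D `&` (U `&` V k)) < e%:E.
  apply: nonincreasing_small => //.
  - move=> k l kl; apply/subsetPset; apply: setIS; apply: setIS => x /= /lt_le_trans.
    by apply; rewrite lerD2l lef_pV2 ?posrE// ler_nat.
  - apply: le_lt_trans Dfin; apply: le_measure; rewrite ?inE//.
  - rewrite (_ : \bigcap_k _ = set0) ?measure0//.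
    apply/seteqP; split=> x //= H.
    have [_ [Ux _]] := H 0%N I.
    have /ltr_add_invr[k kx] := Ux.
    by have [_ [_]] := H k I; rewrite /V/= ltNge (ltW kx).
exists U, (V k); split => //.
- split; [|exact: mlt]; rewrite (_ : U = (fun x : 'rV[R]_n => x ord0 i) @^-1` [set t | a < t]%R)//.
  by apply: open_comp => [x _|]; [exact: coord_continuous|exact: open_gt].
- split; [|exact: mgt].
  rewrite (_ : V k = (fun x : 'rV[R]_n => x ord0 i) @^-1` [set t | t < a + k.+1%:R^-1]%R)//.
  by apply: open_comp => [x _|]; [exact: coord_continuous|exact: open_lt].
- by move=> x /= /negP; rewrite -leNgt => /le_lt_trans; apply; rewrite ltrDl.
Qed.

Lemma sigma_algebra_separable_by_open : sigma_algebra setT separable_by_open.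
Proof.
split; first exact: separable_by_open0.
  by move=> A; rewrite setTD; exact: separable_by_openC.
exact: separable_by_open_bigcup.
Qed.

(** The sets separable by open sets form a sigma-algebra, and the Borel sets are
    generated by the half-spaces orthogonal to the axes. *)
Lemma borel_separable_by_open A : measurable A -> separable_by_open A.
Proof.
apply: smallest_sub; first exact: sigma_algebra_separable_by_open.
rewrite -bigcup_seq; apply: bigcup_sub => i _ _ [B mB <-]; rewrite setTI.
have {mB} : (@RGenOInfty.G R).-sigma.-measurable B.
  by rewrite -RGenOInfty.measurableE.
move: B.
apply: (@smallest_sub _ _ _ [set B | separable_by_open ((fun x : 'rV[R]_n => x ord0 i) @^-1` B)]).
  split=> /=.
  - by rewrite preimage_set0; exact: separable_by_open0.
  - by move=> B sB; rewrite setTD preimage_setC; exact: separable_by_openC.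
  - by move=> B sB; rewrite preimage_bigcup; exact: separable_by_open_bigcup.
move=> _ [a ->] /=.
rewrite (_ : _ @^-1` _ = [set x : 'rV[R]_n | (a < x ord0 i)%R]).
  exact: separable_by_open_halfspace.
by apply/seteqP; split=> x /=; rewrite in_itv/= andbT.
Qed.

End borel.

Local Notation mu := (@lebesgue_rV R n).

(** Cover E by Borel sets of almost the same total measure, and approximate
    their union by an open set. *)
Lemma lebesgue_outer_open (E : set 'rV[R]_n) c (r e : R) : (0 < r)%R -> (0 < e)%R ->
  E `<=` ball c r -> exists U : set 'rV[R]_n,
    [/\ open U, measurable U, E `<=` U, U `<=` ball c r & mu U <= mu E + e%:E].
Proof.
move=> r0 e0 EB; pose m := lebesgue_borel_rV R n.
have mB := measurable_ball_rV c r.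
have Bfin : m (ball c r) < +oo by rewrite /m lebesgue_borel_ball// ltry.
have e20 : (0 < e / 2)%R by rewrite divr_gt0.
have Efin : mu E \is a fin_num.
  rewrite ge0_fin_numE; last exact: mu_ext_ge0.
  by apply: le_lt_trans (le_mu_ext _ EB) _; rewrite measurable_mu_extE.
have [_ [A [mA EA] <-] Ae] := lb_ereal_inf_adherent e20 Efin.
pose A' := \bigcup_k A k.
have mA' : measurable A' by exact: bigcupT_measurable.
have [_ /(_ _ e20)[U [V [[oU mU] [_ mV] AU AV UV]]]] :=
  borel_separable_by_open mB Bfin mA'.
have mUB : measurable (U `&` ball c r) by exact: measurableI.
exists (U `&` ball c r); split => //.
- by apply: openI => //; exact: ball_open.
- by move=> x Ex; split; [exact/AU/EA|exact: EB].
rewrite lebesgue_rVE// [e]splitr EFinD addeA.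
apply: (@le_trans _ _ (m (A' `|` (ball c r `&` (U `&` V))))).
  apply: le_measure; rewrite ?inE//.
    by apply: measurableU => //; apply: measurableI => //; exact: measurableI.
  move=> x [Ux Bx]; have [Ax|nAx] := pselect (A' x); [by left|right].
  by split => //; split => //; exact: AV.
apply: le_trans (measureU2 m mA' _) _.
  by apply: measurableI => //; exact: measurableI.
apply: leeD; last exact: ltW.
apply: le_trans (ltW Ae).
exact: measure_sigma_subadditive.
Qed.

End outer_regularity.

(** * A covering inequality *)

Section covering.
Context {R : realType} {n : nat}.
Local Open Scope ereal_scope.
Local Notation mu := (@lebesgue_rV R n).
Local Notation T := (lebesgueType R n).

Lemma ball_absorb (c d : 'rV[R]_n) (r t : R) : (t <= r)%R ->
  ball c r `&` ball d t !=set0 -> ball d t `<=` ball c (3 * r)%R.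
Proof.
move=> tr [z [cz dz]] y dy.
have := ball_triangle (ball_triangle cz (ball_sym dz)) dy.
by apply: le_ball; lra.
Qed.

Variables (cen : nat -> 'rV[R]_n) (rad : nat -> R).
Hypothesis rad_gt0 : forall k, (0 < rad k)%R.
Let b k : set T := ball (cen k) (rad k).

Let mb k : measurable (b k).
Proof. exact: measurable_lebesgue_ball. Qed.

Let mbs (P : set nat) : measurable (\bigcup_(k in P) b k).
Proof. by apply: bigcup_measurable => k _; exact: mb. Qed.

Variables (nu : set T -> \bar R) (a : R).
Hypothesis a_ge0 : (0 <= a)%R.
Hypothesis nu_ge0 : forall A, 0 <= nu A.
Hypothesis nu_superadd : forall A B, measurable A -> measurable B -> A `<=` B ->
  nu A + nu (B `\` A) <= nu B.

(** A form of Vitali's covering lemma with the measure bookkeeping done along the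
    selection: take the ball i of largest radius; every ball meeting it lies in
    its triple, of measure 3^n mu (b i), and the remaining balls are handled by
    induction inside U minus b i, so that the nu-masses add up to at most
    nu U. *)
Lemma covering_finite (s : seq nat) (U : set T) : measurable U ->
  (forall k, k \in s -> b k `<=` U) ->
  (forall k, k \in s -> mu (b k) <= a%:E * nu (b k)) ->
  mu (\bigcup_(k in [set` s]) b k) <= (3 ^+ n * a)%:E * nu U.
Proof.
have [N] := ubnP (size s); elim: N s U => // N IH s U sN mU sU sa.
have ca_ge0 : 0 <= (3 ^+ n * a)%:E by rewrite lee_fin mulr_ge0// exprn_ge0.
have [->|s0] := eqVneq s [::].
  rewrite (_ : [set` [::]] = set0) ?bigcup_set0 ?measure0 ?mule_ge0//.
  by apply/seteqP; split.
have [i is_ imax] : exists2 i, i \in s & forall j, j \in s -> (rad j <= rad i)%R.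
  elim: s s0 {sN sU sa} => // x s ih _.
  have [->|/ih[i is_ imax]] := eqVneq s [::].
    by exists x => [|j]; rewrite inE// => /eqP ->.
  have [xi|ix] := leP (rad x) (rad i).
    exists i => [|j]; first by rewrite inE is_ orbT.
    by rewrite inE => /orP[/eqP ->//|/imax].
  exists x => [|j]; first by rewrite inE eqxx.
  by rewrite inE => /orP[/eqP ->//|/imax ji]; rewrite (le_trans ji)// ltW.
pose disj k := `[< b i `&` b k = set0 >].
(* Since i itself is dropped, s' is strictly shorter than s. *)
pose s' := [seq k <- s | disj k].
have s's k : k \in s' -> k \in s by rewrite mem_filter => /andP[].
have idisj : ~~ disj i.
  apply/asboolPn; rewrite setIid => bi0.
  by have : set0 (cen i) by rewrite -bi0; exact: ballxx.
have IHs' : mu (\bigcup_(k in [set` s']) b k) <= (3 ^+ n * a)%:E * nu (U `\` b i).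
  apply: IH.
  - rewrite -ltnS; apply: leq_trans sN; rewrite ltnS size_filter -(count_predC disj s).
    by rewrite -addn1 leq_add2l -has_count; apply/hasP; exists i.
  - by apply: measurableD.
  - move=> k; rewrite mem_filter => /andP[/asboolP ik ks] x bkx.
    split; first exact: sU bkx.
    by move=> bix; have : set0 x by rewrite -ik.
  - by move=> k /s's; exact: sa.
pose b3 : set T := ball (cen i) (3 * rad i)%R.
have mb3 : measurable b3 by exact: measurable_lebesgue_ball.
apply: (@le_trans _ _ (mu (b3 `|` \bigcup_(k in [set` s']) b k))).
  apply: le_measure; rewrite ?inE//; first exact: measurableU.
  move=> x [k /= ks bkx]; have [dk|ndk] := boolP (disj k).
    by right; exists k => //=; rewrite mem_filter dk.
  left; move: x bkx; apply: ball_absorb; first exact: imax.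
  by apply/set0P/eqP => ik; move/asboolP : ndk; apply.
apply: le_trans (measureU2 _ mb3 (mbs _)) _.
apply: (@le_trans _ _ ((3 ^+ n * a)%:E * (nu (b i) + nu (U `\` b i)))); last first.
  by rewrite lee_wpmul2l// nu_superadd//; exact: sU.
rewrite ge0_muleDr//; apply: leeD => //.
have mub3 : mu b3 = (3 ^+ n)%:E * mu (b i).
  rewrite /b3 /b !lebesgue_ball ?mulr_gt0// -EFinM -exprMn.
  by congr (_ ^+ _)%:E; rewrite mulrCA.
rewrite [leLHS]mub3.
by rewrite [in leRHS]EFinM -muleA lee_wpmul2l ?lee_fin ?exprn_ge0// sa.
Qed.

(** Continuity from below extends the bound from finite subfamilies. *)
Lemma covering_countable (P : set nat) (U E : set T) :
  measurable U -> measurable E ->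
  (forall k, P k -> b k `<=` U) ->
  (forall k, P k -> mu (b k) <= a%:E * nu (b k)) ->
  E `<=` \bigcup_(k in P) b k ->
  mu E <= (3 ^+ n * a)%:E * nu U.
Proof.
move=> mU mE PU Pa EP.
pose s N := [seq k <- iota 0 N | `[< P k >]].
pose F N := \bigcup_(k in [set` s N]) b k.
have mF N : measurable (F N) by exact: mbs.
have mFF : measurable (\bigcup_N F N) by exact: bigcupT_measurable.
have sP N k : k \in s N -> P k by rewrite mem_filter => /andP[/asboolP].
have ndF : nondecreasing_seq F.
  move=> N M NM; apply/subsetPset => x [k /=]; rewrite mem_filter => /andP[Pk kN] bkx.
  exists k => //=; rewrite mem_filter Pk/=; move: kN.
  by rewrite !mem_iota !add0n !leq0n/= => /leq_trans; apply.
apply: (@le_trans _ _ (mu (\bigcup_N F N))).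
  apply: le_measure; rewrite ?inE//; apply: subset_trans EP _ => x [k Pk bkx].
  exists k.+1 => //; exists k => //=; rewrite mem_filter mem_iota add0n/= ltnSn andbT.
  exact/asboolP.
have muF := @nondecreasing_cvg_mu _ T R mu F mF mFF ndF.
rewrite -(cvg_lim _ muF)//; apply: lime_le; first by apply/cvg_ex; eexists; exact: muF.
apply: nearW => N; apply: covering_finite => // k /sP Pk; [exact: PU|exact: Pa].
Qed.

End covering.

(** * Lebesgue points *)

(** Differentiation along a countable family of balls keeps the exceptional sets
    measurable and their coverings countable; any other ball is contained in one
    of the family of comparable radius. *)
Lemma rational_balls (R : realType) n : exists (cen : nat -> 'rV[R]_n) (rad : nat -> R),
  (forall k, 0 < rad k) /\
  forall x r, 0 < r -> exists2 k, ball x r `<=` ball (cen k) (rad k) & rad k <= 2 * r.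
Proof.
pose dec k : 'rV[rat]_n * rat := odflt (0, 1) (unpickle k).
pose rad k : R := let t := ratr (dec k).2 in if 0 < t then t else 1.
exists (fun k => map_mx ratr (dec k).1), rad; split.
  by move=> k; rewrite /rad; case: ifPn.
move=> x r r0.
have /choice[y yP] : forall i, exists q : rat, `|x ord0 i - ratr q| < r / 4.
  move=> i; have : x ord0 i - r / 4 < x ord0 i + r / 4 by lra.
  by move=> /rat_in_itvoo[q]; rewrite in_itv/= => qx; exists q; rewrite distrC ltr_distl.
have [t] : exists t : rat, ratr t \in `](3 / 2 * r), (2 * r)[.
  by apply: rat_in_itvoo; lra.
rewrite in_itv/= => /andP[t1 t2].
exists (pickle (\row_i y i, t)); rewrite /rad /dec pickleK/=.
  rewrite ifT; last by apply: lt_trans t1; lra.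
  move=> z xz; have le_t : r / 4 + r <= ratr t by lra.
  apply: (le_ball le_t); apply: ball_triangle xz.
  rewrite ballE_rV ?divr_gt0// => i; rewrite !mxE distrC; exact: yP.
by rewrite ifT ?ltW//; apply: lt_trans t1; lra.
Qed.

Section lebesgue_points.
Context {R : realType} {n : nat}.
Local Notation mu := (@lebesgue_rV R n).
Local Notation T := (lebesgueType R n).

Lemma L1loc_integrable_sub_cst (f : 'rV[R]_n -> R) (q : R) c r : L1loc f ->
  mu.-integrable (ball c r) (EFin \o (fun x => f x - q)).
Proof.
move=> f1; have [r0|r0] := ltP 0 r; last first.
  rewrite (_ : ball c r = set0); first exact: integrable_set0.
  by apply/seteqP; split=> x //= []; rewrite ltNge r0.
have mB : measurable (ball c r : set T) := measurable_lebesgue_ball c r.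
have qi : mu.-integrable (ball c r) (EFin \o cst q).
  apply: measurable_bounded_integrable => //.
    by have := ltry ((2 * r) ^+ n); rewrite -(@lebesgue_ball R n c).
  by exists `|q|; split => [|t qt x _]; [exact: num_real|exact: ltW].
have := integrableB mB (L1loc_integrable_ball c r f1) qi.
by apply: eq_integrable.
Qed.

Variable f : 'rV[R]_n -> R.
Hypothesis f1 : L1loc f.
Variables (cen : nat -> 'rV[R]_n) (rad : nat -> R).
Hypothesis rad_gt0 : forall k, 0 < rad k.
Hypothesis radP : forall x r, 0 < r ->
  exists2 k, ball x r `<=` ball (cen k) (rad k) & rad k <= 2 * r.

Let integrable_sub_cst (q : R) c r := L1loc_integrable_sub_cst q c r f1.
Local Notation b k := (ball (cen k) (rad k)).

(** The set function nu to which the covering inequality is applied. *)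
Definition osc (q : R) (A : set T) : \bar R := (\int[mu]_(x in A) `|f x - q|%:E)%E.

(** The points of a cube where f is within eps of q although |f - q| has, on
    arbitrarily small balls of the family containing the point, averages above a
    fixed multiple of eps. The factor 2 * 3 ^+ n is twice the constant of the
    covering inequality. *)
Definition bad_set (q eps : R) (W : R) : set T :=
  [set x | [/\ ball 0 W x, `|f x - q| < eps &
    forall m, exists k, [/\ rad k < m.+1%:R^-1, b k x &
      ((2 * 3 ^+ n * eps)%:E * mu (b k) < osc q (b k))%E]]].

Let mfq (q : R) : measurable_fun setT (fun x : T => `|f x - q|).
Proof.
have [mf _] := f1.
have mfB : measurable_fun setT (fun x : T => f x - q).
  by apply: measurable_funB; [exact: mf|exact: measurable_cst].
exact: (measurableT_comp (@normr_measurable R setT) mfB).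
Qed.

Let mosc (q : R) (A : set T) : measurable_fun A (fun x : T => `|f x - q|%:E).
Proof. by apply: measurable_funTS; apply/measurable_EFinP; exact: mfq. Qed.

Lemma measurable_bad_set q eps W : measurable (bad_set q eps W).
Proof.
rewrite (_ : bad_set q eps W = ball 0 W `&` ((fun x : T => `|f x - q|) @^-1` `]-oo, eps[)
  `&` \bigcap_m \bigcup_(k in [set k | rad k < m.+1%:R^-1 /\
      ((2 * 3 ^+ n * eps)%:E * mu (b k) < osc q (b k))%E]) b k).
  apply: measurableI.
    apply: measurableI; first exact: measurable_lebesgue_ball.
    by rewrite -[X in measurable X]setTI; apply: (mfq q).
  apply: bigcapT_measurable => m; apply: bigcup_measurable => k _.
  exact: measurable_lebesgue_ball.
apply/seteqP; split=> x /=.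
  move=> [Bx fx H]; split; first by split; rewrite //= in_itv.
  by move=> m _; have [k [? ? ?]] := H m; exists k.
move=> [[Bx]]; rewrite in_itv/= => fx H; split => // m.
by have [k [? ?] ?] := H m I; exists k.
Qed.

Lemma osc_superadd q (A B : set T) : measurable A -> measurable B -> A `<=` B ->
  (osc q A + osc q (B `\` A) <= osc q B)%E.
Proof.
move=> mA mB AB; rewrite /osc -(ge0_integral_setU mu mA (measurableD mB mA)).
- by rewrite setDUK.
- exact: mosc.
- by move=> x _; rewrite lee_fin.
- by rewrite disj_set2E setDIK.
Qed.

Lemma osc_abs_cont q c r (e : R) : 0 < e -> exists2 d : R, 0 < d &
  forall A : set T, measurable A -> A `<=` ball c r -> (mu A < d%:E)%E ->
    (osc q A < e%:E)%E.
Proof.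
move=> e0; pose B : set T := ball c r.
have mB : measurable B by exact: measurable_lebesgue_ball.
have gi : mu.-integrable B (EFin \o (fun x => f x - q)).
  exact: integrable_sub_cst.
have gi' : mu.-integrable setT (EFin \o ((fun x => f x - q) \_ B)).
  by have /(integrable_mkcond _ mB) := gi; rewrite restrict_EFin.
have [d [d0 H]] := integral_normr_continuous gi' e0.
exists d => // A mA AB Ad; have := H A mA Ad.
rewrite -lte_fin fineK.
  congr (_ < _)%E; apply: eq_integral => x /set_mem Ax.
  by rewrite patchE ifT// inE; exact: AB.
have /(integrable_norm) := integrableS measurableT mA (@subsetT _ A) gi'.
exact: integrable_fin_num.
Qed.

(** Enclose the bad set E in an open set U with little extra measure. Then
    osc U is at most eps mu(E) + e, because |f - q| < eps on E and the integral
    is absolutely continuous. The covering inequality for the balls inside U on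
    which |f - q| has a large average gives
    mu(E) <= osc U / (2 eps) <= mu(E) / 2 + e / (2 eps); as mu(E) is finite, it
    is at most e / eps for every e. *)
Lemma bad_set_null q eps W : 0 < eps -> 0 < W -> mu (bad_set q eps W) = 0%E.
Proof.
move=> eps0 W0; set E := bad_set q eps W.
have mE : measurable E := measurable_bad_set q eps W.
have EB : E `<=` ball 0 W by move=> x [].
have Efin : mu E \is a fin_num.
  rewrite ge0_fin_numE ?measure_ge0//.
  apply: (@le_lt_trans _ _ (mu (ball 0 W))).
    by apply: le_measure; rewrite ?inE//; exact: measurable_lebesgue_ball.
  by rewrite lebesgue_ball// ltry.
pose delta := 2 * 3 ^+ n * eps.
have delta0 : 0 < delta by rewrite !mulr_gt0// exprn_gt0.
have main (e : R) : 0 < e -> (mu E <= (e / eps)%:E)%E.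
  move=> e0; have [d d0 Hd] := osc_abs_cont q 0 W e0.
  have d20 : 0 < d / 2 by rewrite divr_gt0.
  have [U [oU mU0 EU UB muU]] := lebesgue_outer_open W0 d20 EB.
  have mU : measurable (U : set T) := measurable_borel_lebesgue mU0.
  have mUE : measurable (U `\` E : set T) by exact: measurableD.
  have oscUE : (osc q (U `\` E) < e%:E)%E.
    apply: Hd => //; first by move=> x [/UB].
    rewrite measureD//; last by apply: le_lt_trans muU _; rewrite -(fineK Efin) -EFinD ltry.
    rewrite setIidr// lteBlDl//.
    by apply: le_lt_trans muU _; rewrite lteD2lE// lte_fin; lra.
  have oscE : (osc q E <= eps%:E * mu E)%E.
    rewrite -(integral_cst mu mE); apply: (ge0_le_integral mu mE).
    - by move=> x _; rewrite lee_fin.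
    - exact: mosc.
    - exact: measurable_cst.
    - by move=> x [_ fx _]; rewrite lee_fin ltW.
  have oscU : (osc q U <= eps%:E * mu E + e%:E)%E.
    rewrite -[X in osc q X](setDUK EU) /osc (ge0_integral_setU mu mE mUE).
    - by apply: leeD; [exact: oscE|exact: ltW].
    - exact: mosc.
    - by move=> x _; rewrite lee_fin.
    - by rewrite disj_set2E setDIK.
  have := @covering_countable R n cen rad rad_gt0 (osc q) delta^-1 _ _ (@osc_superadd q)
    [set k | b k `<=` U /\ (delta%:E * mu (b k) < osc q (b k))%E] U E mU mE _ _ _.
  have -> : 3 ^+ n * delta^-1 = (2 * eps)^-1.
    by rewrite /delta mulrAC invfM mulrC -mulrA mulVf ?mulr1// expf_neq0// pnatr_eq0.
  move=> cov; have {cov} : (mu E <= ((2 * eps)^-1)%:E * osc q U)%E.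
    apply: cov.
    - by rewrite invr_ge0 ltW.
    - by move=> A; apply: integral_ge0.
    - by move=> k [].
    - by move=> k [_ /ltW kb]; rewrite -lee_pdivlMl// in kb *.
    - move=> x Ex.
      have [rho /= rho0 xU] : exists2 rho : R, 0 < rho & ball x rho `<=` U.
        have /nbhs_ballP[rho rho0 ?] := open_nbhs_nbhs (conj oU (EU _ Ex)).
        by exists rho.
      have /ltr_add_invr[m] : 0 < rho / 2 by rewrite divr_gt0.
      rewrite add0r => mrho; have [_ _ /(_ m)[k [km bkx bk]]] := Ex.
      exists k => //; split => // y bky; apply: xU.
      have krho := lt_trans km mrho.
      have := ball_triangle (ball_sym bkx) bky; apply: le_ball.
      by rewrite [leRHS]splitr lerD// ltW.
  move=> /le_trans/(_ (lee_wpmul2l _ oscU)).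
  have e2 : 0 < 2 * eps by rewrite mulr_gt0.
  rewrite -(fineK Efin) => H.
  have {}H : fine (mu E) <= (2 * eps)^-1 * (eps * fine (mu E) + e).
    by rewrite -lee_fin EFinM EFinD EFinM; apply: H; rewrite lee_fin invr_ge0 ltW.
  by rewrite lee_fin ler_pdivlMr//; move: H; rewrite ler_pdivlMl//; lra.
apply/eqP; rewrite eq_le measure_ge0 andbT; apply/lee_addgt0Pr => e e0.
rewrite add0e; have := main (e * eps) (mulr_gt0 e0 eps0).
by rewrite mulfK ?gt_eqF.
Qed.

(** A small ball around x lies in a ball of the family of at most twice its
    radius, which costs 2^n; replacing q by f x costs eps. *)
Lemma osc_small_outside_bad (q eps W : R) (x : 'rV[R]_n) : 0 < eps ->
  ball 0 W x -> `|f x - q| < eps -> ~ bad_set q eps W x ->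
  exists2 rho : R, 0 < rho & forall r, 0 < r < rho ->
    \int[mu]_(y in ball x r) `|f y - f x| <=
      ((2 * 3 ^+ n * 2 ^+ n + 1) * eps) * (2 * r) ^+ n.
Proof.
move=> eps0 xW fx nbad.
have [m Hm] : exists m, forall k, rad k < m.+1%:R^-1 -> b k x ->
    (osc q (b k) <= (2 * 3 ^+ n * eps)%:E * mu (b k))%E.
  apply/not_existsP => H; apply: nbad; split => // m.
  have /existsNP[k /not_implyP[km /not_implyP[bkx /negP]]] := H m.
  by rewrite -ltNge => bk; exists k.
exists (m.+1%:R^-1 / 2); first by rewrite divr_gt0// invr_gt0.
move=> r /andP[r0 rm]; have [k rk rk2] := radP x r0.
have km : rad k < m.+1%:R^-1.
  by apply: le_lt_trans rk2 _; rewrite mulrC -ltr_pdivlMr.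
have := Hm k km (rk _ (ballxx _ r0)); rewrite lebesgue_ball// -EFinM => oscb.
have mB : measurable (ball x r : set T) := measurable_lebesgue_ball x r.
have oscr : (osc q (ball x r) <= (2 * 3 ^+ n * eps * (2 ^+ n * (2 * r) ^+ n))%:E)%E.
  apply: (@le_trans _ _ (osc q (b k))).
    apply: (ge0_subset_integral mu mB (measurable_lebesgue_ball _ _) _ _ rk).
      exact: mosc.
    by move=> y _; rewrite lee_fin.
  apply: le_trans oscb _; rewrite lee_fin ler_wpM2l//.
    by rewrite !mulr_ge0 ?exprn_ge0// ltW.
  by rewrite -exprMn lerXn2r ?nnegrE ?mulr_ge0 ?(ltW r0) ?(ltW (rad_gt0 k))// ler_wpM2l.
have iq := integrable_norm (integrable_sub_cst q x r).
have iqq : mu.-integrable (ball x r) (EFin \o cst eps).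
  have := integrableB mB (integrable_sub_cst 0 x r) (integrable_sub_cst eps x r).
  by apply: eq_integrable => // y _ /=; rewrite subr0 -EFinB opprB addrC subrK.
have iD : mu.-integrable (ball x r) (EFin \o (fun y => `|f y - q| + eps)).
  by have := integrableD mB iq iqq; apply: eq_integrable.
apply: (@le_trans _ _ (\int[mu]_(y in ball x r) (`|f y - q| + eps))).
  apply: le_Rintegral => //; first exact/integrable_norm/integrable_sub_cst.
  move=> y _; rewrite -[f y - f x](subrKA q) (le_trans (ler_normD _ _))//.
  by rewrite lerD2l distrC ltW.
rewrite RintegralD// Rintegral_cst//.
have -> : fine (mu (ball x r)) = (2 * r) ^+ n by rewrite lebesgue_ball.
have I1 : \int[mu]_(y in ball x r) `|f y - q| <=
    2 * 3 ^+ n * eps * (2 ^+ n * (2 * r) ^+ n).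
  by rewrite -lee_fin fineK//; exact: (integrable_fin_num mB iq).
apply: le_trans (lerD I1 (lexx _)) _.
by rewrite le_eqVlt; apply/predU1P; left; ring.
Qed.

End lebesgue_points.

(** Every value f x is approximated by rationals q, so the points outside the
    countably many bad sets with parameters q, 1 / (m + 1) and W + 1 are Lebesgue
    points. *)
Lemma lebesgue_differentiation_rV (R : realType) n (f : 'rV[R]_n -> R) :
  L1loc f ->
  {ae lebesgue_rV R n, forall x : 'rV[R]_n, forall e : R, 0 < e ->
    exists2 rho : R, 0 < rho & forall r, 0 < r < rho ->
      \int[lebesgue_rV R n]_(y in ball x r) `|f y - f x| <= e * (2 * r) ^+ n}.
Proof.
move=> f1; have [cen [rad [rad0 radP]]] := rational_balls R n.
pose par k : rat * nat * nat := odflt (0%R, 0%N, 0%N) (unpickle k).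
pose N k := bad_set f cen rad (ratr (par k).1.1) ((par k).1.2.+1%:R^-1) ((par k).2.+1%:R).
have N0 : (lebesgue_rV R n).-negligible (\bigcup_k N k).
  apply: negligible_bigcup => k; apply/negligibleP.
    exact: measurable_bad_set.
  by apply: bad_set_null.
apply: negligibleS N0 => x /= /existsNP[e] /not_implyP[e0 H].
apply: contrapT => nN; apply: H.
pose c : R := 2 * 3 ^+ n * 2 ^+ n + 1.
have c0 : 0 < c by rewrite addr_gt0// !mulr_gt0// exprn_gt0.
have /ltr_add_invr[m] : 0 < e / c by rewrite divr_gt0.
rewrite add0r => me.
have eps0 : 0 < m.+1%:R^-1 :> R by rewrite invr_gt0.
have : f x - m.+1%:R^-1 < f x + m.+1%:R^-1 by rewrite ltrBlDr -addrA ltrDl addr_gt0.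
move=> /rat_in_itvoo[q]; rewrite in_itv/= -ltr_distl distrC => fq.
have [W xW] : exists W : nat, ball 0 W.+1%:R x.
  exists (Num.truncn `|x|).
  rewrite mx_norm_ball /ball_/= sub0r normrN.
  exact: truncnS_gt.
have [|rho rho0 Hrho] := @osc_small_outside_bad R n f f1 cen rad rad0 radP (ratr q)
    (m.+1%:R^-1) (W.+1%:R) x eps0 xW fq.
  by move=> bad; apply: nN; exists (pickle (q, m, W)) => //; rewrite /N /par pickleK.
exists rho => // r rr; apply: le_trans (Hrho r rr) _.
rewrite ler_wpM2r//.
  by rewrite exprn_ge0// mulr_ge0// ltW//; case/andP: rr.
by rewrite mulrC -ler_pdivlMr// ltW.
Qed.

(** * Averages and projections on comparable balls *)

Section averages.
Context {R : realType} {n : nat}.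
Hypothesis n_gt0 : (0 < n)%N.
Implicit Types (x y c : 'rV[R]_n) (r : R).
Local Notation mu := (@lebesgue_rV R n).

Lemma avgE (g : 'rV[R]_n -> R) c r : 0 < r ->
  mu.-integrable (eball c r) (EFin \o g) ->
  avg g (eball c r) = (ravg g (eball c r))%:E.
Proof.
move=> r0 gi; have mB := @measurable_eball R n c r.
rewrite /avg /ravg volE inver gt_eqF ?vol_eball_gt0// EFinM muleC; congr (_ * _)%E.
by rewrite fineK//; exact: (integrable_fin_num mB (integrable_norm gi)).
Qed.

Lemma ravg_sub (g : 'rV[R]_n -> R) c r c' r' (L : R) : 0 < r -> 0 < r' ->
  mu.-integrable (eball c r) (EFin \o g) ->
  eball c' r' `<=` eball c r -> vol (eball c r) <= L * vol (eball c' r') ->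
  ravg g (eball c' r') <= L * ravg g (eball c r).
Proof.
move=> r0 r'0 gi sub volL.
have V0 := vol_eball_gt0 c n_gt0 r0; have V'0 := vol_eball_gt0 c' n_gt0 r'0.
have mB := @measurable_eball R n c r; have mB' := @measurable_eball R n c' r'.
have Ile : \int[mu]_(y in eball c' r') `|g y| <= \int[mu]_(y in eball c r) `|g y|.
  rewrite -lee_fin !fineK.
  - apply: (ge0_subset_integral mu mB' mB _ _ sub) => [|y _].
      by case/integrableP : (integrable_norm gi).
    by rewrite lee_fin.
  - exact: (integrable_fin_num mB (integrable_norm gi)).
  - exact: (integrable_fin_num mB' (integrable_norm (integrableS mB mB' sub gi))).
have I0 : 0 <= \int[mu]_(y in eball c r) `|g y| by apply: Rintegral_ge0.
rewrite /ravg ler_pdivrMr// [leRHS](_ : _ =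
  (\int[mu]_(y in eball c r) `|g y|) * (L * vol (eball c' r')) / vol (eball c r)).
  rewrite ler_pdivlMr//; apply: ler_pM => //; [exact: Rintegral_ge0|exact: ltW].
by ring.
Qed.

Lemma vol_eball_comparable c r c' r' (t : R) : 0 < r -> 0 < r' -> 0 <= t ->
  eball c r `<=` eball c' (t * r') -> vol (eball c r) <= (t * n%:R) ^+ n * vol (eball c' r').
Proof.
move=> r0 r'0 t0 sub.
have tr0 : 0 < t * r' by have := eball_radius_gt0 (sub _ (eball_center c r0)).
apply: (@le_trans _ _ (vol (eball c' (t * r')))).
  rewrite -lee_fin -!volE; apply: le_measure; rewrite ?inE//; exact: measurable_eball.
apply: le_trans (vol_eball_le c' tr0) _.
apply: (@le_trans _ _ ((t * n%:R) ^+ n * (2 * r' / n%:R) ^+ n)).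
  have n0 : n%:R != 0 :> R by rewrite pnatr_eq0 -lt0n.
  by rewrite -exprMn le_eqVlt; apply/predU1P; left; congr (_ ^+ _); field.
by rewrite ler_wpM2l ?vol_eball_ge// exprn_ge0// mulr_ge0.
Qed.

End averages.

Section telescoping.
Context {R : realType} {n : nat} (n_gt0 : (0 < n)%N) (s : nat).
Implicit Types (x y c : 'rV[R]_n) (r : R).
Variables (f : 'rV[R]_n -> R) (f1 : L1loc f).
Variable C1 : R.
Hypothesis C1_gt0 : 0 < C1.
Hypothesis mproj_le : forall g p q c r, 0 < r ->
  (@lebesgue_rV R n).-integrable (eball c r) (EFin \o g) ->
  is_mproj s g (eball c r) p -> (msize q <= s.+1)%N ->
  forall x, eball c (3 * r) x ->
    `|evalp p x - evalp q x| <= C1 * ravg (fun y => g y - evalp q y) (eball c r).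
Local Notation mu := (@lebesgue_rV R n).
Local Notation P B := (mproj s f B).

Let Pproj c r : 0 < r -> is_mproj s f (eball c r) (P (eball c r)).
Proof. by move=> r0; apply: mproj_is_mproj => //; exact: L1loc_integrable_eball. Qed.

Let sP c r : 0 < r -> (msize (P (eball c r)) <= s.+1)%N.
Proof. by move=> /(Pproj c)[]. Qed.

(** The projection on the larger ball serves as the comparison polynomial q for the
    smaller one; the point x may lie outside the smaller ball, but it is in its
    triple. *)
Lemma mproj_change_ball c r c' r' x (t : R) : 0 < r -> 0 < r' -> 0 <= t ->
  t <= 3 -> eball c' r' `<=` eball c r -> eball c r `<=` eball c' (t * r') ->
  eball c r x ->
  `|evalp (P (eball c' r')) x - evalp (P (eball c r)) x| <=
    C1 * (3 * n%:R) ^+ n *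
    ravg (fun y => f y - evalp (P (eball c r)) y) (eball c r).
Proof.
move=> r0 r'0 t0 t3 sub sup xc.
have x3 : eball c' (3 * r') x.
  by apply: (eball_subset (r := t * r')) (sup _ xc); rewrite ler_wpM2r// ltW.
apply: le_trans (mproj_le r'0 (L1loc_integrable_eball _ _ f1) (Pproj c' r'0) (sP c r0) x3) _.
rewrite -mulrA ler_wpM2l ?(ltW C1_gt0)//.
apply: ravg_sub => //.
  by apply: integrable_sub_evalp; exact: L1loc_integrable_eball.
apply: le_trans (vol_eball_comparable n_gt0 r0 r'0 t0 sup) _.
have V0 := vol_eball_gt0 c' n_gt0 r'0.
by rewrite ler_pM2r// lerXn2r ?nnegrE ?mulr_ge0// ler_wpM2r.
Qed.

(** The comparison polynomial is the constant f x, so the projection on B(x, r)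
    is close to f x as soon as f has small mean deviation from f x. *)
Lemma mproj_to_value x (e rho r : R) : 0 <= e -> 0 < r < rho ->
  (forall r, 0 < r < rho ->
    \int[mu]_(y in ball x r) `|f y - f x| <= e * (2 * r) ^+ n) ->
  `|evalp (P (eball x r)) x - f x| <= C1 * n%:R ^+ n * e.
Proof.
move=> e0 rr H; have /andP[r0 _] := rr; have {}H := H r rr.
have sc : (msize (mpolyC n (f x)) <= s.+1)%N by rewrite msizeC (leq_trans (leq_b1 _)).
have Ec y : evalp (mpolyC n (f x)) y = f x by exact: mevalC.
have x3 : eball x (3 * r) x by apply: eball_center; rewrite mulr_gt0.
have := mproj_le r0 (L1loc_integrable_eball _ _ f1) (Pproj x r0) sc x3.
rewrite Ec => /le_trans; apply; rewrite -mulrA ler_wpM2l ?(ltW C1_gt0)// /ravg.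
have V0 := vol_eball_gt0 x n_gt0 r0.
have mB := @measurable_eball R n x r.
have mBb := @measurable_lebesgue_ball R n x r.
rewrite ler_pdivrMr//.
have ci : mu.-integrable (ball x r) (EFin \o (fun y => f y - f x)).
  exact: L1loc_integrable_sub_cst.
apply: (@le_trans _ _ (\int[mu]_(y in ball x r) `|f y - f x|)).
  under eq_Rintegral do rewrite Ec.
  have cj := integrableS mBb mB (@eball_sub_ball R n x r) ci.
  rewrite -lee_fin !fineK.
  - apply: (ge0_subset_integral mu mB mBb _ _ (@eball_sub_ball R n x r)) => [|y _].
      by case/integrableP : (integrable_norm ci).
    by rewrite lee_fin.
  - exact: (integrable_fin_num mBb (integrable_norm ci)).
  - exact: (integrable_fin_num mB (integrable_norm cj)).
apply: le_trans H _.
have n0 : n%:R != 0 :> R by rewrite pnatr_eq0 -lt0n.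
have -> : 2 * r = n%:R * (2 * r / n%:R) by field.
rewrite exprMn mulrCA mulrA ler_wpM2l ?vol_eball_ge//.
by rewrite mulr_ge0// exprn_ge0.
Qed.

End telescoping.

(** * The pointwise estimate *)

Theorem lemma3p10 (R : realType) (n k : nat) (n_gt0 : (0 < n)%N)
    (k_gt0 : (0 < k)%N) :
  exists2 C : R, 0 < C &
    forall f : 'rV[R]_n -> R, L1loc f ->
    {ae lebesgue_rV R n, forall x : 'rV[R]_n,
      forall r : R, 0 < r ->
      forall (c : 'rV[R]_n) (rho : R), 0 < rho ->
        eball c rho `<=` eball x r -> eball x r `<=` eball c (3 * rho) ->
        (`|f x - evalp (mproj k.-1 f (eball c rho)) x|%:E <=
         C%:E * \sum_(0 <= j <oo)
           avg (fun y => f y - evalp (mproj k.-1 f (eball x (2 ^- j * r))) y)%R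
             (eball x (2 ^- j * r)))%E}.
Proof.
have [C1 C1_gt0 HC1] := @mproj_sub_le R n n_gt0 k.-1.
pose K := C1 * (3 * n%:R) ^+ n.
have K_gt0 : 0 < K by rewrite mulr_gt0// exprn_gt0// mulr_gt0// ltr0n.
(* One K for the telescoping sum, one for the passage from B1 to B. *)
exists (2 * K) => [|f f1]; first by rewrite mulr_gt0.
apply: negligibleS (lebesgue_differentiation_rV f1) => x.
apply: contra_not => Lx r r0 c rho rho0 sub sup.
pose rad j : R := 2 ^- j * r.
have rad0 j : 0 < rad j by rewrite mulr_gt0// invr_gt0 exprn_gt0.
have radS j : rad j = 2 * rad j.+1.
  by rewrite /rad exprS invfM !mulrA divff// mul1r.
pose P j := mproj k.-1 f (eball x (rad j)).
pose A j := ravg (fun y => f y - evalp (P j) y) (eball x (rad j)).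
have avgA j : avg (fun y => f y - evalp (P j) y) (eball x (rad j)) = (A j)%:E.
  by apply: avgE => //; apply: integrable_sub_evalp; exact: L1loc_integrable_eball.
under eq_eseriesr do rewrite avgA.
have A0 j : (0 <= (A j)%:E)%E by rewrite lee_fin ravg_ge0.
set S := (\sum_(_ <= _ <oo) _)%E.
have S0 : (0 <= S)%E by apply: nneseries_ge0.
(* A divergent series makes the bound trivial. *)
have [Soo|Sfin] := eqVneq S +oo%E.
  by rewrite Soo gt0_muley ?leey// lte_fin mulr_gt0.
have /fineK SE : S \is a fin_num by rewrite ge0_fin_numE// ltey.
have partial J : \sum_(0 <= j < J) A j <= fine S.
  by rewrite -lee_fin SE -sumEFin; apply: nneseries_lim_ge.
have A0S : A 0%N <= fine S by have := partial 1%N; rewrite big_nat1.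
have step j : `|evalp (P j.+1) x - evalp (P j) x| <= K * A j.
  apply: (mproj_change_ball n_gt0 f1 C1_gt0 HC1 (t := 2)) => //.
  - exact: ler_nat.
  - by apply: eball_subset; rewrite (radS j) ler_peMl ?ler1n ?ltW.
  - by rewrite -radS.
  - exact: eball_center.
have first : `|evalp (mproj k.-1 f (eball c rho)) x - evalp (P 0%N) x| <= K * A 0%N.
  have radr : rad 0%N = r by rewrite /rad expr0 invr1 mul1r.
  rewrite /A /P radr.
  apply: (mproj_change_ball n_gt0 f1 C1_gt0 HC1 (t := 3)) => //.
  exact: eball_center.
have tele J : `|evalp (P J) x - evalp (P 0%N) x| <= K * \sum_(0 <= j < J) A j.
  rewrite -(@telescope_sumr _ 0 J (fun j => evalp (P j) x))//.
  rewrite (le_trans (ler_norm_sum _ _ _))// mulr_sumr.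
  by apply: ler_sum => j _; exact: step.
rewrite -SE -EFinM; apply/lee_addgt0Pr => e e0; rewrite -EFinD lee_fin.
pose e' := e / (C1 * n%:R ^+ n).
have Cn0 : 0 < C1 * n%:R ^+ n by rewrite mulr_gt0// exprn_gt0// ltr0n.
have e'0 : 0 < e' by rewrite divr_gt0.
have [rho' rho'0 Hrho'] := Lx e' e'0.
have [J radJ] : exists J, rad J < rho'.
  have /ltr_add_invr[m] : 0 < rho' / r by rewrite divr_gt0.
  rewrite add0r ltr_pdivlMr// => mr; exists m.+1; apply: le_lt_trans mr.
  rewrite ler_pM2r// lef_pV2 ?posrE ?exprn_gt0//.
  by rewrite -natrX ler_nat ltnW// ltn_expl.
have radJ' : 0 < rad J < rho' by rewrite rad0.
have := mproj_to_value n_gt0 f1 C1_gt0 HC1 (ltW e'0) radJ' Hrho'.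
rewrite -/(P J) /e' mulrC divfK ?gt_eqF// => last.
set b := evalp (mproj _ _ _) x in first *.
have split3 (a u v : R) : a - b = - (u - a) + (u - v) - (b - v) by ring.
rewrite (split3 _ (evalp (P J) x) (evalp (P 0%N) x)) (le_trans (ler_normB _ _))//.
rewrite (le_trans (lerD (ler_normD _ _) (lexx _)))//.
rewrite normrN (le_trans (lerD (lerD last (tele J)) first))//.
have KS : K * \sum_(0 <= j < J) A j <= K * fine S by rewrite ler_pM2l.
have KA : K * A 0%N <= K * fine S by rewrite ler_pM2l.
by rewrite -[leLHS]addrA [leLHS]addrC lerD2r -[leRHS]mulrA [leRHS]mulr_natl mulr2n lerD.
Qed.
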